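(* Let $K$ be a field and let $(X,\sigma)$ be a Deaconu--Renault system with $X$ totally disconnected, such that the Steinberg algebra $A_K(G(X,\sigma))$ is infinite-dimensional. Then the following are equivalent: (1) $A_K(G(X,\sigma))$, with its standard $\mathbb Z$-grading, is graded just infinite; (2) for every proper nonempty closed $(\sigma,\sigma^{-1})$-invariant subset $W\subsetneq X$, the space $W$ is finite and $\operatorname{dom}\bigl((\sigma|_W)^{|W|}\bigr)=\emptyset$.
   Context: A Deaconu--Renault system is a pair $(X,\sigma)$ where $X$ is a locally compact Hausdorff space and $\sigma:\operatorname{dom}(\sigma)\to X$ is a local homeomorphism defined on an open subset $\operatorname{dom}(\sigma)\subseteq X$. Set $\operatorname{dom}(\sigma^0)=X$, $\sigma^0=\mathrm{id}_X$, $\operatorname{dom}(\sigma^{n+1})=\{x\in\operatorname{dom}(\sigma^n):\sigma^n(x)\in\operatorname{dom}(\sigma)\}$ and $\sigma^{n+1}(x)=\sigma(\sigma^n(x))$. A subset $W\subseteq X$ is $(\sigma,\sigma^{-1})$-invariant if $\sigma(W\cap\operatorname{dom}(\sigma))\subseteq W$ and $\sigma^{-1}(W)\subseteq W$. For such $W$, $\sigma|_W:W\cap\operatorname{dom}(\sigma)\to W$ is the restriction, and its iterates and their domains are defined by $\operatorname{dom}((\sigma|_W)^0)=W$, $(\sigma|_W)^0=\mathrm{id}_W$, $\operatorname{dom}((\sigma|_W)^{n+1})=\{x\in\operatorname{dom}((\sigma|_W)^n):(\sigma|_W)^n(x)\in W\cap\operatorname{dom}(\sigma)\}$ and $(\sigma|_W)^{n+1}(x)=\sigma|_W((\sigma|_W)^n(x))$.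 The Deaconu--Renault groupoid is $G(X,\sigma)=\{(x,k,y)\in X\times\mathbb Z\times X:\exists\, m,n\ge0,\ k=m-n,\ x\in\operatorname{dom}(\sigma^m),\ y\in\operatorname{dom}(\sigma^n),\ \sigma^m(x)=\sigma^n(y)\}$, with $r(x,k,y)=x$, $s(x,k,y)=y$, $(x,k,y)(y,\ell,z)=(x,k+\ell,z)$, $(x,k,y)^{-1}=(y,-k,x)$, unit space identified with $X$ via $x\leftrightarrow(x,0,x)$, and topology generated by the sets $Z(U,m,n,V)=\{(x,m-n,y): x\in U,\ y\in V,\ \sigma^m(x)=\sigma^n(y)\}$, with $m,n\ge0$ and $U\subseteq\operatorname{dom}(\sigma^m)$, $V\subseteq\operatorname{dom}(\sigma^n)$ open such that $\sigma^m|_U$, $\sigma^n|_V$ are homeomorphisms onto their images. When $X$ is totally disconnected this is an ample Hausdorff groupoid. The Steinberg algebra of an ample Hausdorff groupoid $G$ is $A_K(G)=\mathrm{span}_K\{1_U:U\subseteq G\text{ a compact open bisection}\}$ with convolution product, determined by $1_U*1_V=1_{UV}$ (a bisection is a set on which $r$ and $s$ are injective). The standard $\mathbb Z$-grading of $A_K(G(X,\sigma))$ is induced by $c(x,k,y)=k$: the degree-$k$ component is $\mathrm{span}_K\{1_U:U\subseteq c^{-1}(k)\text{ a compact open bisection}\}$. A graded ideal of $A=\bigoplus_k A_k$ is an ideal $I$ with $I=\bigoplus_k(A_k\cap I)$; $A$ is graded just infinite if $\dim_K A=\infty$ and $\dim_K A/J<\infty$ for every nonzero graded ideal $J$. *)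

(* Defs.v *)
From HB Require Import structures.
From mathcomp Require Import all_boot all_order all_algebra.
From mathcomp Require Import finmap.
From mathcomp Require Import mathcomp_extra boolp classical_sets functions.
From mathcomp Require Import cardinality fsbigop topology numfun.

Set Implicit Arguments.
Unset Strict Implicit.
Unset Printing Implicit Defensive.

Import Order.TTheory GRing.Theory Num.Theory.

Local Open Scope classical_set_scope.
Local Open Scope ring_scope.

Section PartialMaps.
Variable X : topologicalType.
Implicit Types (U D Y W : set X) (f : X -> X).

(* A partial map is a total function [f] together with its domain [D]; the
   values of [f] outside [D] are junk and are never used. *)

(* [f] restricts to a homeomorphism from [U] onto [f @` U], both carrying the
   subspace topology. *)
Definition homeo_onto_image U f :=
  {within U, continuous f} /\
  exists2 g : X -> X, {within f @` U, continuous g} &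
    forall x, U x -> g (f x) = x.

Definition local_homeo D f :=
  forall x, D x -> exists U,
    [/\ open U, U x, U `<=` D, open (f @` U) & homeo_onto_image U f].

(* Domain of the n-th iterate of a partial map [f : D -> Y] with [D `<=` Y]; on
   this set the n-th iterate is [iter n f]. *)
Fixpoint iter_dom Y D f (n : nat) : set X :=
  if n is n'.+1 then
    [set x | iter_dom Y D f n' x /\ D (iter n' f x)]
  else Y.

Record dr_system := DRSystem {
  dr_dom : set X;
  dr_map : X -> X;
  dr_locally_compact : locally_compact [set: X];
  dr_hausdorff : hausdorff_space X;
  dr_dom_open : open dr_dom;
  dr_local_homeo : local_homeo dr_dom dr_map
}.

Definition dr_invariant (S : dr_system) W :=
  dr_map S @` (W `&` dr_dom S) `<=` W /\
  dr_dom S `&` dr_map S @^-1` W `<=` W.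

(* dom(sigma^n) *)
Definition dr_iter_dom (S : dr_system) := iter_dom setT (dr_dom S) (dr_map S).

(* dom((sigma|_W)^n) *)
Definition dr_restr_iter_dom (S : dr_system) W :=
  iter_dom W (W `&` dr_dom S) (dr_map S).

End PartialMaps.

Section Groupoid.
Variables (X : topologicalType) (S : dr_system X).
Let sigma := dr_map S.

Definition dr_mem (t : X * int * X) : Prop :=
  exists m n : nat, [/\ t.1.2 = m%:Z - n%:Z,
    dr_iter_dom S m t.1.1, dr_iter_dom S n t.2 &
    iter m sigma t.1.1 = iter n sigma t.2].

(* A fresh record, so that the topology below does not compete with the
   subspace topology of the product X * int * X. *)
Record dr_groupoid := DRGroupoid {
  dr_triple : X * int * X;
  _ : `[< dr_mem dr_triple >]
}.

HB.instance Definition _ := [isSub for dr_triple].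
HB.instance Definition _ := [Choice of dr_groupoid by <:].

Definition rng (g : dr_groupoid) : X := (dr_triple g).1.1.
Definition deg (g : dr_groupoid) : int := (dr_triple g).1.2.
Definition src (g : dr_groupoid) : X := (dr_triple g).2.

Definition dr_Z (U : set X) (m n : nat) (V : set X) : set dr_groupoid :=
  [set g | [/\ U (rng g), V (src g), deg g = m%:Z - n%:Z &
               iter m sigma (rng g) = iter n sigma (src g)]].

Definition dr_subbase : set (set dr_groupoid) :=
  [set B | exists (U V : set X) (m n : nat),
     [/\ open U /\ U `<=` dr_iter_dom S m, open V /\ V `<=` dr_iter_dom S n,
         homeo_onto_image U (iter m sigma), homeo_onto_image V (iter n sigma) &
         B = dr_Z U m n V]].

HB.instance Definition _ :=
  isSubBaseTopological.Build dr_groupoid dr_subbase id.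

(* [a] and [b] are composable and [g] is the product a b *)
Definition is_comp (a b g : dr_groupoid) : Prop :=
  src a = rng b /\ dr_triple g = (rng a, deg a + deg b, src b).

Definition compact_open_bisection (U : set dr_groupoid) :=
  [/\ compact U, open U, set_inj U rng & set_inj U src].

End Groupoid.

Section Algebra.
Variables (K : fieldType) (V : lmodType K).
Implicit Types (A B J : set V).

Definition lspan B : set V :=
  [set v | exists (n : nat) (b : 'I_n -> V) (c : 'I_n -> K),
     (forall i, B (b i)) /\ v = \sum_(i < n) c i *: b i].

Definition finite_dim A := exists2 B, finite_set B & A = lspan B.

(* The images of the elements of [B] span the quotient A / J. *)
Definition finite_dim_quotient A J :=
  exists B, [/\ finite_set B, B `<=` A &
    forall a, A a -> exists2 b, lspan B b & J (a - b)].

Definition linear_subspace J :=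
  J 0 /\ forall (c : K) u v, J u -> J v -> J (c *: u + v).

Definition fin_supp_family (F : int -> set V) (v : int -> V) :=
  (forall k, F k (v k)) /\ finite_set [set k | v k != 0].

Definition is_direct_sum J (F : int -> set V) :=
  J = [set \sum_(k \in setT) v k | v in fin_supp_family F] /\
  forall v w, fin_supp_family F v -> fin_supp_family F w ->
    \sum_(k \in setT) v k = \sum_(k \in setT) w k -> v = w.

(* In what follows the algebra is carried by the subspace [A] of [V], with
   product [mul] (no unit is required) and homogeneous components [Agr k]. *)

Definition is_ideal (mul : V -> V -> V) A J :=
  [/\ linear_subspace J, J `<=` A &
      forall a x, A a -> J x -> J (mul a x) /\ J (mul x a)].

Definition graded_ideal (mul : V -> V -> V) A (Agr : int -> set V) J :=
  is_ideal mul A J /\ is_direct_sum J (fun k => Agr k `&` J).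

Definition graded_just_infinite (mul : V -> V -> V) A (Agr : int -> set V) :=
  ~ finite_dim A /\
  forall J, graded_ideal mul A Agr J -> J <> [set 0] ->
    finite_dim_quotient A J.

End Algebra.

Section Steinberg.
Variables (K : fieldType) (X : topologicalType) (S : dr_system X).
Notation G := (dr_groupoid S).

(* [K^o] is [K] seen as a vector space over itself. *)
Definition steinberg : set (G -> K^o) :=
  lspan [set \1_U | U in @compact_open_bisection X S].

Definition steinberg_deg (k : int) : set (G -> K^o) :=
  lspan [set \1_U | U in
    [set U | compact_open_bisection U /\ U `<=` [set g | deg g = k]]].

(* (f * h)(g) is the sum of f(a) h(b) over all factorisations g = a b; for f
   and h in the Steinberg algebra only finitely many terms are nonzero. *)
Definition conv (f h : G -> K^o) : G -> K^o :=
  fun g => \sum_(p \in [set p : G * G | is_comp p.1 p.2 g]) (f p.1 * h p.2).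

(* 1_U * 1_V = 1_{UV} *)
Lemma conv_indic (U V : set G) :
  compact_open_bisection U -> compact_open_bisection V ->
  conv \1_U \1_V =
  \1_[set g | exists a b, [/\ U a, V b & is_comp a b g]].
Proof.
move=> [_ _ injU _] [_ _ _ injV]; apply/funext => g.
have nz p : is_comp p.1 p.2 g -> (\1_U p.1 * \1_V p.2 : K) != 0 ->
    U p.1 /\ V p.2.
  move=> _; rewrite mulf_eq0 negb_or /indic.
  case: (boolP (p.1 \in U)) => [|_]; last by rewrite eqxx.
  case: (boolP (p.2 \in V)) => [|_]; last by rewrite eqxx andbF.
  by rewrite !inE.
rewrite /conv [RHS]/indic; have [|gUV] := boolP (g \in _).
  rewrite inE => -[a [b [Ua Vb abg]]].
  have uniq_ab p : is_comp p.1 p.2 g ->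
      (\1_U p.1 * \1_V p.2 : K) != 0 -> p = (a, b).
    move=> pg /(nz _ pg) [Up Vp]; case: abg pg => _ gE [_].
    rewrite gE => -[rr _ ss]; case: p rr ss Up Vp => a' b' /= rr ss Ua' Vb'.
    by congr (_, _); [apply: injU | apply: injV]; rewrite ?inE.
  transitivity (\1_U a * \1_V b : K^o); last by rewrite /indic !mem_set// mulr1.
  transitivity (\sum_(p \in [set (a, b)]) (\1_U p.1 * \1_V p.2 : K^o)).
    symmetry; apply: fsbig_widen => [_ -> //|p /= [pg pab]].
    by apply/eqP/negPn/negP => /(uniq_ab _ pg).
  by rewrite fsbig_set1.
rewrite fsbig1// => -[a b] /= abg; apply/eqP/negPn/negP => /(nz (a, b) abg).
by case=> Ua Vb; case/negP: gUV; rewrite inE; exists a, b.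
Qed.

End Steinberg.

(* Main.v *)
Require Import Defs.
From mathcomp Require Import all_boot all_order all_algebra.
From mathcomp Require Import finmap.
From mathcomp Require Import boolp classical_sets functions.
From mathcomp Require Import cardinality fsbigop topology numfun.
From mathcomp Require Import zify.

(** Every arrow of degree zero is determined by its range and source, so the
    degree zero part of the groupoid is a principal groupoid. This forces the
    graded ideals of the Steinberg algebra to correspond to the open invariant
    subsets of [X]: the ideal attached to an open invariant set with complement
    [W] consists of the functions that vanish on the arrows over [W], and the
    quotient by it is the algebra of the groupoid reduced to [W]. The algebra is
    thus graded just infinite exactly when, for each closed invariant [W] other
    than [X], the reduction to [W] has a finite-dimensional algebra; and that
    happens exactly when the reduction is a finite set of arrows.

    Half of this correspondence suffices in each direction. For (1) => (2),
    [vanishing_graded_ideal] says that the functions vanishing over [W] form a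
    graded ideal, and [finite_reduction] bounds the number of arrows over [W] by
    the dimension of the quotient. Finitely many arrows leave room for finitely
    many units and for no periodic point, because a periodic point has isotropy
    in infinitely many degrees; and an orbit in a finite [W] without periodic
    points stops after fewer than [#|W|] steps.

    For (2) => (1), a graded ideal [J] is compared with the set
    [ideal_support J] of units [x] having a compact open neighbourhood [V] whose
    indicator lies in [J]. A nonzero homogeneous element of [J] can be moved to
    degree zero by a bisection and then cut down around a unit to a multiple of
    such an indicator ([ideal_support_homogeneous]), so the set is nonempty; the
    same lemma shows that it is invariant ([ideal_support_arrow]). Functions in
    the algebra that vanish off it lie in [J] ([ideal_vanishing]). Its complement
    therefore satisfies the conclusion of (2) or is empty, so only finitely many
    arrows lie over it ([acyclic_finite_reduction]), and functions on these
    arrows span the quotient by [J].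

    All topology of the groupoid goes through [nbhs_dr_groupoid], which describes
    the neighbourhoods of an arrow by any of its pairs of exponents. *)

Set Implicit Arguments.
Unset Strict Implicit.
Unset Printing Implicit Defensive.

Import Order.TTheory GRing.Theory Num.Theory.

Local Open Scope classical_set_scope.
Local Open Scope ring_scope.

(** * Compact open neighbourhoods in the unit space *)

Section CompactOpenBase.
Variable X : topologicalType.
Implicit Types (A B D K : set X).

(** Compactness in the only form needed for separation arguments: members of a
    filter that avoid the points of a compact set one at a time can be replaced by
    a single member that avoids them all. *)
Lemma compact_filter_sep A (F : set_system X) : Filter F -> compact A ->
  (forall a, A a -> exists2 V, F V & ~ closure V a) ->
  exists2 V, F V & A `&` closure V = set0.
Proof.
move=> FF /compact_near_coveringP cA sepA.
have [F0|F0] := pselect (F set0); first by exists set0; rewrite ?closure0 ?setI0.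
have PF : ProperFilter F by [].
have [] := cA _ _ (fun V a => ~ closure V a) (powerset_filter_from_filter PF).
  move=> a /sepA [V FV Va].
  exists (~` closure V, [set U | U `<=` V]); first split => /=.
  - by apply: open_nbhs_nbhs; split=> //; exact/closed_openC/closed_closure.
  - apply/near_powerset_filter_fromP; first by move=> ? ?; exact: subset_trans.
    by exists V.
  - by move=> [a' U] /= [Va' UV] /(closureS UV).
move=> /= E [EF _ [V EV]] /(_ V EV) AV; exists V; first exact: EF.
by rewrite -subset0 => a [/AV].
Qed.

Hypothesis hX : hausdorff_space X.

Lemma compact_separation A B : compact A -> compact B -> A `&` B = set0 ->
  exists U V, [/\ open U, open V, A `<=` U, B `<=` V & U `&` V = set0].
Proof.
move=> cA cB AB0.
have [V sBV AV0] : exists2 V, set_nbhs B V & A `&` closure V = set0.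
  apply: compact_filter_sep => // a Aa.
  have [U aU BU0] : exists2 U, nbhs a U & B `&` closure U = set0.
    apply: compact_filter_sep => // b Bb; move: hX; rewrite open_hausdorff.
    case/(_ a b).
      by apply: contraPneq AB0 => ab; rewrite predeqE => /(_ a)[+ _]; apply;
         split=> //; rewrite ab.
    move=> [U V] /= [/[!inE] Ua Vb] [oU oV UV0].
    exists U; first exact: open_nbhs_nbhs.
    move=> /(_ _ (open_nbhs_nbhs (conj oV Vb))) [z UVz].
    by have : set0 z by rewrite -UV0.
  exists (~` closure U).
    move=> b Bb; apply: open_nbhs_nbhs; split.
      exact/closed_openC/closed_closure.
    by move=> Ub; have : set0 b by rewrite -BU0.
  move=> /(_ _ aU) [z [nUz Uz]]; apply: nUz; exact: subset_closure.
have [W [oW BW WV]] := (set_nbhsP _ _).1 sBV.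
exists (~` closure V), W; split=> //.
- exact/closed_openC/closed_closure.
- by move=> a Aa Va; have : set0 a by rewrite -AV0.
- by rewrite -subset0 => z [nVz /WV Vz]; apply: nVz; exact: subset_closure.
Qed.

(** The relatively clopen subsets of [K] through [x]: the family whose
    intersection is the quasi-component of [x] in [K]. *)
Definition clopen_part K x : set (set X) :=
  [set D | [/\ D x, D `<=` K, closed D & closed (K `\` D)]].

Lemma clopen_part_self K x : closed K -> K x -> clopen_part K x K.
Proof. by move=> clK Kx; split=> //; rewrite setDv; exact: closed0. Qed.

Lemma clopen_part_filter K x : closed K -> K x ->
  Filter (filter_from (clopen_part K x) id).
Proof.
move=> clK Kx; apply: filter_from_filter.
  by exists K; exact: clopen_part_self.
move=> D D' [Dx DK cD cKD] [D'x D'K cD' cKD']; exists (D `&` D') => //; split=> //.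
- by move=> z [/DK].
- exact: closedI.
- by rewrite setDIr; exact: closedU.
Qed.

(** If the quasi-component [Q] of [x] split into two disjoint closed pieces, the
    pieces would have disjoint neighbourhoods; by compactness some [D] of the
    family already lies in their union, and cutting [D] along the neighbourhood
    that holds [x] gives a member of the family that misses the other piece.
    Hence [Q] is connected, so it is the singleton of [x]. *)
Lemma clopen_part_separates K x y :
  totally_disconnected [set: X] -> compact K -> K x -> K y -> x <> y ->
  exists2 D, clopen_part K x D & ~ D y.
Proof.
move=> tdX cK Kx Ky xy.
have clK : closed K by exact: compact_closed.
have FF := clopen_part_filter clK Kx.
pose Q := \bigcap_(D in clopen_part K x) D.
apply: contrapT => noD.
have Qy : Q y by move=> D DD; apply: contrapT => nDy; apply: noD; exists D.
have Qx : Q x by move=> D [].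
have clQ : closed Q by apply: closed_bigI => D [].
have QK : Q `<=` K by move=> z; apply; exact: clopen_part_self.
suff cQ : connected Q.
  suff : connected_component setT x y by rewrite (tdX x I) => /= yx; exact: xy.
  by exists Q.
apply: contrapT => /connectedPn [E [E0 QE [sepE1 sepE2]]].
have EQ b : E b `<=` Q by rewrite QE; case: b => z; [right|left].
have clE b : closed (E b).
  move=> z clz; have : Q z by apply: clQ; exact: closureS clz.
  rewrite QE; case: b clz => clz [] // Ez.
  - by have : set0 z by rewrite -sepE2.
  - by have : set0 z by rewrite -sepE1.
have cE b : compact (E b).
  by apply: subclosed_compact cK _ => //; exact: subset_trans QK.
have disj b : E b `&` E (~~ b) = set0.
  rewrite -subset0 => z EEz; rewrite -sepE1; case: b EEz => /= -[Ez E'z].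
    by split=> //; exact: subset_closure.
  by split=> //; exact: subset_closure.
have [b Ebx] : exists b, E b x.
  by move: Qx; rewrite QE => -[]; [exists false|exists true].
have [U [V [oU oV EU EV UV0]]] := compact_separation (cE b) (cE (~~ b)) (disj b).
have [D0 [D [Dx DK cD cKD] DD0] KUV] :
    exists2 D0, filter_from (clopen_part K x) id D0 &
      (K `&` ~` (U `|` V)) `&` closure D0 = set0.
  apply: compact_filter_sep => //.
    by apply: compact_closedI => //; apply: open_closedC; exact: openU.
  move=> a [Ka nUVa].
  have /existsNP[D /not_implyP[DDD nDa]] : ~ Q a.
    by rewrite QE => -[] Ea; apply: nUVa; case: (b) EU EV => EU EV;
      [right; exact: EV|left; exact: EU|left; exact: EU|right; exact: EV].
  exists D; first by exists D.
  by case: DDD => _ _ + _; rewrite closure_id => <-.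
have DUV : D `<=` U `|` V.
  move=> z Dz; apply: contrapT => nz.
  suff : set0 z by [].
  rewrite -KUV; split; first by split=> //; exact: DK.
  exact/subset_closure/DD0.
have DUE : D `&` U = D `\` V.
  rewrite predeqE => z; split=> -[Dz] => [Uz|nVz]; split=> //.
    by move=> Vz; have : set0 z by rewrite -UV0.
  by case: (DUV _ Dz).
have DUDD : clopen_part K x (D `&` U).
  split.
  - by split=> //; exact: EU.
  - by move=> z [/DK].
  - by rewrite DUE; apply: closedI => //; exact: open_closedC.
  - rewrite setDIr; apply: closedU => //.
    by apply: closedI => //; exact: open_closedC.
have [z Ez] := E0 (~~ b).
have [Dz Uz] := EQ _ _ Ez _ DUDD.
suff : set0 z by [].
by rewrite -UV0; split=> //; exact: EV.
Qed.

(** A relatively clopen part of a compact neighbourhood that stays inside an open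
    set [O] is the complement in [O] of a closed set, hence open. *)
Lemma compact_open_base (x : X) (N : set X) :
  locally_compact [set: X] -> totally_disconnected [set: X] -> nbhs x N ->
  exists U, [/\ compact U, open U, U x & U `<=` N].
Proof.
move=> lcX tdX xN.
have [K xK [cK clK]] : exists2 K, nbhs x K & compact K /\ closed K.
  by have := lcX x I; rewrite withinET => -[K ? ?]; exists K.
have : nbhs x (N `&` K) by exact: filterI.
rewrite nbhsE => -[O [oO Ox] ONK].
have Kx : K x by have [] := ONK _ Ox.
have FF := clopen_part_filter clK Kx.
have [D0 [D [Dx DK cD cKD] DD0] KOD] :
    exists2 D0, filter_from (clopen_part K x) id D0 &
      (K `&` ~` O) `&` closure D0 = set0.
  apply: compact_filter_sep => //.
    by apply: compact_closedI => //; exact: open_closedC.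
  move=> a [Ka nOa].
  have [|D DD nDa] := clopen_part_separates tdX cK Kx Ka.
    by move=> xa; apply: nOa; rewrite -xa.
  exists D; first by exists D.
  by case: DD => _ _ + _; rewrite closure_id => <-.
have DO : D `<=` O.
  move=> z Dz; apply: contrapT => nOz; suff : set0 z by [].
  rewrite -KOD; split; first by split=> //; exact: DK.
  exact/subset_closure/DD0.
exists D; split=> //.
- exact: subclosed_compact cK _.
- have -> : D = O `&` ~` (K `\` D); last first.
    by apply: openI => //; exact: closed_openC.
  rewrite predeqE => z; split=> [Dz|[Oz nKD]].
    by split; [exact: DO|move=> []].
  by apply: contrapT => nDz; apply: nKD; split=> //; have [] := ONK _ Oz.
- by move=> z /DO /ONK [].
Qed.

End CompactOpenBase.

(** * Iterates of a partial local homeomorphism *)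

Section Iterates.
Variables (X : topologicalType) (S : dr_system X).
Local Notation sigma := (dr_map S).
Local Notation dom := (dr_iter_dom S).
Implicit Types (x y : X) (U N : set X) (m n : nat).

Lemma iter_shift n m x : iter n sigma (iter m sigma x) = iter (m + n) sigma x.
Proof. by rewrite addnC iterD. Qed.

Lemma dr_iter_domD m n x : dom (m + n) x <-> dom m x /\ dom n (iter m sigma x).
Proof.
elim: n => [|n IHn]; first by rewrite addn0; split=> [|[]].
rewrite addnS /= /dr_iter_dom /= -/(dr_iter_dom _ _) iter_shift.
by split=> [[/IHn[]]|[? []]] //; split=> //; apply/IHn.
Qed.

Lemma dr_iter_dom_le m n x : (m <= n)%N -> dom n x -> dom m x.
Proof. by move=> /subnKC <- /dr_iter_domD[]. Qed.

Lemma dr_map_continuous x : dr_dom S x -> {for x, continuous sigma}.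
Proof.
move=> /(dr_local_homeo (d:=S)) [U [oU Ux _ _ [/subspace_continuousP cf _]]].
move=> N /(cf _ Ux); rewrite /= nbhs_simpl => UN.
have /within_interior <- // : U° x by apply: open_nbhs_nbhs.
Qed.

Lemma dr_map_nbhs_image x N :
  dr_dom S x -> nbhs x N -> nbhs (sigma x) (sigma @` N).
Proof.
move=> /(dr_local_homeo (d:=S)) [U [oU Ux _ ofU]].
move=> [_ [g /subspace_continuousP cg gK]] xN.
have fUx : (sigma @` U) (sigma x) by exists x.
have gN : nbhs (g (sigma x)) (N `&` U).
  by rewrite gK//; apply: filterI => //; exact: open_nbhs_nbhs.
have H : \forall z \near sigma x, (sigma @` U) z -> (N `&` U) (g z).
  exact: (cg _ fUx _ gN).
have fU : nbhs (sigma x) (sigma @` U) by exact: open_nbhs_nbhs.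
apply: filterS (filterI H fU) => z [+ fUz] => /(_ fUz) [Ngz _].
by case: fUz Ngz => u Uu <-; rewrite gK// => Nu; exists u.
Qed.

Lemma dr_map_loc_inj x : dr_dom S x ->
  exists2 U, nbhs x U & forall y z, U y -> U z -> sigma y = sigma z -> y = z.
Proof.
move=> /(dr_local_homeo (d:=S)) [U [oU Ux _ ofU [_ [g _ gK]]]].
exists U; first exact: open_nbhs_nbhs.
by move=> y z Uy Uz yz; rewrite -(gK _ Uy) yz gK.
Qed.

Lemma iter_continuous m x : dom m x -> {for x, continuous (iter m sigma)}.
Proof.
elim: m => [|m IHm] /=; first by move=> _; exact: cvg_id.
move=> [domx Dx]; apply: continuous_comp; first exact: IHm.
exact: dr_map_continuous.
Qed.

Lemma dr_iter_dom_nbhs m x : dom m x -> nbhs x (dom m).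
Proof.
elim: m => [|m IHm] /=; first by move=> _; exact: filterT.
move=> [domx Dx]; apply: filterI; first exact: IHm.
apply: (iter_continuous domx); apply: open_nbhs_nbhs; split=> //.
exact: dr_dom_open.
Qed.

(** Iterates of a local homeomorphism are open maps, here at the level of
    neighbourhoods so that the domain need not be carried along. *)
Lemma iter_nbhs_image m x N :
  dom m x -> nbhs x N -> nbhs (iter m sigma x) (iter m sigma @` N).
Proof.
elim: m => [|m IHm] /=; first by move=> _; rewrite image_id.
move=> [domx Dx] /(IHm domx) /(dr_map_nbhs_image Dx).
by apply: filterS => z [_ [y Ny <-] <-]; exists y.
Qed.

Lemma iter_loc_inj m x : dom m x -> exists2 U, nbhs x U &
  forall y z, U y -> U z -> iter m sigma y = iter m sigma z -> y = z.
Proof.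
elim: m => [|m IHm] /=; first by exists setT => //; exact: filterT.
move=> [domx Dx]; have [U xU Uinj] := IHm domx.
have [V xV Vinj] := dr_map_loc_inj Dx.
exists (U `&` iter m sigma @^-1` V).
  by apply: filterI => //; exact: iter_continuous xV.
by move=> y z [Uy Vy] [Uz Vz] /Vinj => /(_ Vy Vz); exact: Uinj.
Qed.

(** Openness of the iterate makes the inverse of an injective restriction
    continuous. Through this lemma and [homeo_onto_image_inj], the homeomorphism
    conditions in the subbase of the groupoid reduce to injectivity. *)
Lemma homeo_onto_image_iter m U : open U -> U `<=` dom m ->
  (forall y z, U y -> U z -> iter m sigma y = iter m sigma z -> y = z) ->
  homeo_onto_image U (iter m sigma).
Proof.
move=> oU Udom Uinj; split.
  apply/subspace_continuousP => x Ux; apply: cvg_trans (iter_continuous (Udom _ Ux)).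
  by apply: cvg_app; exact: cvg_within.
have [g gK] : exists g : X -> X, forall x, U x -> g (iter m sigma x) = x.
  have /choice [g gP] : forall y, exists x, forall x',
      U x' -> iter m sigma x' = y -> x' = x.
    move=> y; have [[x Ux <-]|nUy] := pselect ((iter m sigma @` U) y).
      by exists x => x' Ux'; exact: Uinj.
    by exists y => x' Ux' x'y; case: nUy; exists x'.
  by exists g => x Ux; apply/esym/gP.
exists g => //; apply/subspace_continuousP => _ [x Ux <-] N.
move=> xN; have {}xN : nbhs x N by rewrite -(gK x Ux).
rewrite /= nbhs_simpl withinE.
exists (iter m sigma @` (U `&` N)); last first.
  rewrite predeqE => y; split=> /= -[].
    move=> Ngy [z Uz zy]; split; last by exists z.
    by exists z => //; split=> //; move: Ngy; rewrite -zy /from_subspace/= gK.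
  move=> [z [Uz Nz] <-] _; split; last by exists z.
  by rewrite /from_subspace/= gK.
apply: iter_nbhs_image; first exact: Udom.
by apply: filterI => //; exact: open_nbhs_nbhs.
Qed.

Lemma homeo_onto_image_inj U (f : X -> X) : homeo_onto_image U f ->
  forall y z, U y -> U z -> f y = f z -> y = z.
Proof. by move=> [_ [g _ gK]] y z Uy Uz fyz; rewrite -(gK _ Uy) fyz gK. Qed.

End Iterates.

(** * Neighbourhoods in the groupoid *)

Section GroupoidTopology.
Variables (X : topologicalType) (S : dr_system X).
Local Notation sigma := (dr_map S).
Local Notation dom := (dr_iter_dom S).
Local Notation G := (dr_groupoid S).
Implicit Types (x y : X) (U V : set X) (m n : nat) (g h : G) (N : set G).

(** The arrow [g] is witnessed by the exponents [m] and [n]. One arrow has many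
    witnesses, and the topology looks the same through each of them
    ([nbhs_dr_groupoid]). *)
Definition lag g m n := [/\ deg g = m%:Z - n%:Z, dom m (rng g),
  dom n (src g) & iter m sigma (rng g) = iter n sigma (src g)].

Lemma lag_exists g : exists m n, lag g m n.
Proof. by case: g => t tP; have /asboolP[m [n [? ? ? ?]]] := tP; exists m, n. Qed.

Lemma dr_groupoid_eq g h : rng g = rng h -> deg g = deg h -> src g = src h ->
  g = h.
Proof.
move=> r d s; apply: val_inj; rewrite /=.
move: r d s; rewrite /rng /deg /src.
by case: (dr_triple g) (dr_triple h) => [[? ?] ?] [[? ?] ?] /= -> -> ->.
Qed.

Lemma arrow_exists x m n y : dom m x -> dom n y ->
  iter m sigma x = iter n sigma y ->
  exists g, [/\ dr_triple g = (x, m%:Z - n%:Z, y), rng g = x, src g = y &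
                lag g m n].
Proof.
move=> mx ny xy; have tP : `[< dr_mem S (x, m%:Z - n%:Z, y) >].
  by apply/asboolP; exists m, n.
by exists (DRGroupoid tP).
Qed.

Lemma open_dr_subbase (N : set G) : dr_subbase N -> open N.
Proof.
move=> sN; exists [set N]; last first.
  by rewrite predeqE => ?; split=> [[_ ->]|] //; exists N.
move=> _ ->; exists [fset N]%fset; first by move=> ? /fset1P ->; rewrite inE.
rewrite predeqE => ?; split=> [|Nx M /fset1P -> //].
by apply; exact: fset11.
Qed.

Lemma iter_homeo_nbhs m x U : dom m x -> nbhs x U -> exists V,
  [/\ open V, V x, V `<=` U, V `<=` dom m & homeo_onto_image V (iter m sigma)].
Proof.
move=> mx xU; have [W xW Winj] := iter_loc_inj mx.
have : nbhs x (U `&` (dom m `&` W)).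
  by apply: filterI => //; apply: filterI => //; exact: dr_iter_dom_nbhs.
rewrite nbhsE => -[V [oV Vx] VUW]; have Vdom z : V z -> dom m z by case/VUW => _ [].
exists V; split=> //; first by move=> z /VUW [].
apply: homeo_onto_image_iter => // y z /VUW[_ [_ Wy]] /VUW[_ [_ Wz]].
exact: Winj.
Qed.

(** The filter that the arrows witnessed by [(m, n)] would generate at [g] if
    range and source were the only other constraints. *)
Definition basic_nbhs g m n N := exists U V, [/\ nbhs (rng g) U, nbhs (src g) V &
  forall h, lag h m n -> U (rng h) -> V (src h) -> N h].

Lemma basic_nbhs_filter g m n : Filter (basic_nbhs g m n).
Proof.
split.
- by exists setT, setT; split=> //; exact: filterT.
- move=> A B [U [V [gU gV A_]]] [U' [V' [gU' gV' B_]]].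
  exists (U `&` U'), (V `&` V'); split; [exact: filterI|exact: filterI|].
  by move=> h hmn [? ?] [? ?]; split; [exact: A_|exact: B_].
- move=> A B AB [U [V [gU gV A_]]]; exists U, V; split=> // h ? ? ?.
  exact/AB/A_.
Qed.

(** A subbasic set given by exponents [(m', n')] contains a basic neighbourhood
    for any other witness [(m, n)]. If [m <= m'], then applying [sigma] to both
    sides of the equation suffices. If [m > m'], then [sigma] has to be cancelled,
    which its iterates allow near one point, being locally injective. *)
Lemma basic_nbhs_dr_Z g m n U m' n' V : lag g m n ->
  open U -> U `<=` dom m' -> open V -> V `<=` dom n' ->
  dr_Z U m' n' V g -> basic_nbhs g m n (dr_Z U m' n' V).
Proof.
move=> [dg mg ng gmn] oU Um oV Vn [Ug Vg dg' gmn'].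
have [le_mm'|lt_m'm] := leqP m m'.
  have [n'E m'E] : n' = (n + (m' - m))%N /\ m' = (m + (m' - m))%N.
    split; last by rewrite subnKC.
    by move: dg'; rewrite dg; lia.
  exists U, V; split; [exact: open_nbhs_nbhs..|] => h [dh mh nh hmn] Uh Vh.
  split=> //; first by rewrite dh -dg.
  by rewrite m'E n'E -!iter_shift hmn.
(* cancel the last [l] steps on a neighbourhood where they are injective *)
pose l := (m - m')%N; have [nE mE] : n = (n' + l)%N /\ m = (m' + l)%N.
  split; last by rewrite subnKC// ltnW.
  by move: dg'; rewrite dg /l; lia.
have [m'g lg] : dom m' (rng g) /\ dom l (iter m' sigma (rng g)).
  by apply/dr_iter_domD; rewrite -mE.
have n'g : dom n' (src g) by exact: Vn.
have [W gW Winj] := iter_loc_inj lg.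
exists (U `&` iter m' sigma @^-1` W), (V `&` iter n' sigma @^-1` W); split.
- apply: filterI; first exact: open_nbhs_nbhs.
  exact: (iter_continuous m'g).
- apply: filterI; first exact: open_nbhs_nbhs.
  by apply: (iter_continuous n'g); rewrite -gmn'.
- move=> h [dh mh nh hmn] [Uh Wh] [Vh Wh']; split=> //; first by rewrite dh -dg.
  by apply: Winj => //; rewrite !iter_shift -mE -nE.
Qed.

(** The main tool about the topology of the groupoid: continuity, openness and
    compactness below are all read off from it, with the witness chosen freely. *)
Lemma nbhs_dr_groupoid g m n N : lag g m n -> nbhs g N <-> basic_nbhs g m n N.
Proof.
move=> gmn; split; last first.
  move=> [U [V [gU gV UVN]]]; case: (gmn) => dg mg ng sg.
  have [U' [oU' U'g U'U U'm hU']] := iter_homeo_nbhs mg gU.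
  have [V' [oV' V'g V'V V'n hV']] := iter_homeo_nbhs ng gV.
  have ZN : dr_Z U' m n V' `<=` N.
    move=> h [U'h V'h dh sh]; apply: UVN; [|exact: U'U|exact: V'V].
    by split=> //; [exact: U'm|exact: V'n].
  suff gZ : nbhs g (dr_Z U' m n V') by exact: filterS gZ.
  apply: open_nbhs_nbhs; split=> //.
  by apply: open_dr_subbase; exists U', V', m, n.
rewrite nbhsE => -[_ [[B sB <-] [C BC Cg] sN]].
have FF := @basic_nbhs_filter g m n.
apply: (@filterS _ _ _ C); first by move=> h Ch; apply: sN; exists C.
have /sB [D sD DC] := BC; rewrite -DC; apply: filter_bigI => E DE.
have := sD _ DE; rewrite inE => -[U [V [m' [n' [[oU Um] [oV Vn] _ _ EE]]]]].
move: Cg; rewrite -DC => /(_ _ DE) /=; rewrite EE.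
exact: basic_nbhs_dr_Z.
Qed.

End GroupoidTopology.

(** * Compact open bisections *)

(** Compactness of [Z] follows from that of [C] along a map [phi] that need not be
    continuous: a cluster point of the image of a filter is either ruled out by a
    neighbourhood that misses the image of [Z], or lifts to a cluster point in
    [Z]. This avoids building inverse maps on subspaces. *)
Lemma compact_transfer (T T' : topologicalType) (C : set T) (Z : set T')
    (phi : T' -> T) : compact C -> (forall z, Z z -> C (phi z)) ->
  (forall c, C c ->
     (exists2 M, nbhs c M & forall z, Z z -> ~ M (phi z)) \/
     (exists2 z, Z z & forall N, nbhs z N ->
        exists2 M, nbhs c M & forall z', Z z' -> M (phi z') -> N z')) ->
  compact Z.
Proof.
move=> cC ZC near_c F PF FZ.
have [|c [Cc clc]] := cC (phi @ F) (fmap_proper_filter phi PF).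
  by rewrite /= nbhs_simpl; apply: filterS FZ; exact: ZC.
have [[M cM ZM]|[z Zz zP]] := near_c c Cc.
  have [|y [[z Zz <-] My]] := clc (phi @` Z) M _ cM.
    by rewrite /fmap/= nbhs_simpl; apply: filterS FZ => z Zz; exists z.
  by case: (ZM z).
exists z; split=> // A N FA /zP [M cM MN].
have [|_ [[y [Ay Zy] <-] My]] := clc (phi @` (A `&` Z)) M _ cM.
  rewrite /fmap/= nbhs_simpl; apply: filterS (filterI FA FZ) => y ?.
  by exists y.
by exists y; split=> //; exact: MN.
Qed.

Lemma hausdorff_near_neq (X T T' : topologicalType) (f : T -> X) (h : T' -> X)
    (t : T) (t' : T') : hausdorff_space X ->
  {for t, continuous f} -> {for t', continuous h} -> f t <> h t' ->
  exists A B, [/\ nbhs t A, nbhs t' B & forall a b, A a -> B b -> f a <> h b].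
Proof.
rewrite open_hausdorff => hX cf ch /eqP /hX [[U V] /= [/[!inE] Ut Vt']].
move=> [oU oV UV0]; exists (f @^-1` U), (h @^-1` V); split.
- by apply: cf; exact: open_nbhs_nbhs.
- by apply: ch; exact: open_nbhs_nbhs.
- move=> a b Ua Vb ab; suff : set0 (f a) by [].
  by rewrite -UV0; split=> //; rewrite ab.
Qed.

Section Bisections.
Variables (X : topologicalType) (S : dr_system X).
Local Notation sigma := (dr_map S).
Local Notation dom := (dr_iter_dom S).
Local Notation G := (dr_groupoid S).
Local Notation bisection := (@compact_open_bisection X S).
Implicit Types (x y : X) (m n : nat) (g h a b : G) (N : set G).

Lemma rng_continuous : continuous (@rng X S).
Proof.
move=> g N gN; have [m [n gmn]] := lag_exists g.
rewrite /= nbhs_simpl; apply/(nbhs_dr_groupoid _ gmn).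
by exists N, setT; split=> //; exact: filterT.
Qed.

Lemma src_continuous : continuous (@src X S).
Proof.
move=> g N gN; have [m [n gmn]] := lag_exists g.
rewrite /= nbhs_simpl; apply/(nbhs_dr_groupoid _ gmn).
by exists setT, N; split=> //; exact: filterT.
Qed.

Lemma deg_locally_constant g : \forall h \near g, deg h = deg g.
Proof.
have [m [n gmn]] := lag_exists g; apply/(nbhs_dr_groupoid _ gmn).
exists setT, setT; split=> //; try exact: filterT.
by case: gmn => -> _ _ _ h [->].
Qed.

Lemma open_deg (k : int) : open [set g : G | deg g = k].
Proof.
by rewrite openE => g <-; exact: deg_locally_constant.
Qed.

Lemma closed_deg (k : int) : closed [set g : G | deg g = k].
Proof.
by move=> g /(_ _ (deg_locally_constant g)) [h [/= <- ->]].
Qed.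

Lemma dr_groupoid_hausdorff : hausdorff_space G.
Proof.
move=> g h gh; apply: dr_groupoid_eq.
- apply: (dr_hausdorff S) => A B gA hB.
  have [z [Az Bz]] := gh _ _ (rng_continuous gA) (rng_continuous hB).
  by exists (rng z).
- by have [z [<- <-]] := gh _ _ (deg_locally_constant g) (deg_locally_constant h).
- apply: (dr_hausdorff S) => A B gA hB.
  have [z [Az Bz]] := gh _ _ (src_continuous gA) (src_continuous hB).
  by exists (src z).
Qed.

(** The set is parametrized by the pairs [(x, y)] with
    [iter m sigma x = iter n sigma y], a closed condition. *)
Lemma compact_dr_Z m n (U V : set X) : compact U -> compact V ->
  U `<=` dom m -> V `<=` dom n -> compact (dr_Z (S := S) U m n V).
Proof.
move=> cU cV Um Vn; apply: (compact_transfer (phi := fun g => (rng g, src g))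
  (compact_setX cU cV)) => [g [] //|[x y] [/= Ux Vy]].
have mx := Um _ Ux; have ny := Vn _ Vy.
have [xy|xy] := pselect (iter m sigma x = iter n sigma y); last first.
  left; have [A [B [xA yB AB]]] := hausdorff_near_neq (dr_hausdorff S)
    (iter_continuous mx) (iter_continuous ny) xy.
  exists (A `*` B); first by exists (A, B).
  by move=> g [Ug Vg _ gmn] [/= Ag Bg]; exact: AB gmn.
right; have [g [_ rg sg gmn]] := arrow_exists mx ny xy.
have gU : U (rng g) by rewrite rg.
have gV : V (src g) by rewrite sg.
exists g; first by case: gmn.
move=> N /(nbhs_dr_groupoid _ gmn) [A [B [gA gB ABN]]].
exists (A `*` B); first by exists (A, B) => //; rewrite -rg -sg.
move=> h [Uh Vh dh hmn] [/= Ah Bh]; apply: ABN => //.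
by split=> //; [exact: Um|exact: Vn].
Qed.

Section TotallyDisconnected.
Hypothesis hX : totally_disconnected [set: X].

(** Shrinking range and source to compact open sets on which the powers of
    [sigma] are injective turns a basic neighbourhood into a bisection. *)
Lemma bisection_base g N : nbhs g N -> exists B, [/\ bisection B, B g & B `<=` N].
Proof.
have [m [n gmn]] := lag_exists g.
move=> /(nbhs_dr_groupoid _ gmn) [U [V [gU gV UVN]]]; have [dg mg ng sg] := gmn.
have base x A (xA : nbhs x A) :=
  compact_open_base (dr_hausdorff S) (dr_locally_compact S) hX xA.
have [U1 [oU1 U1g U1U U1m hU1]] := iter_homeo_nbhs mg gU.
have [V1 [oV1 V1g V1V V1n hV1]] := iter_homeo_nbhs ng gV.
have [U2 [cU2 oU2 U2g U2U1]] := base _ _ (open_nbhs_nbhs (conj oU1 U1g)).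
have [V2 [cV2 oV2 V2g V2V1]] := base _ _ (open_nbhs_nbhs (conj oV1 V1g)).
have U2m : U2 `<=` dom m by move=> z /U2U1 /U1m.
have V2n : V2 `<=` dom n by move=> z /V2V1 /V1n.
have injU2 y z : U2 y -> U2 z -> iter m sigma y = iter m sigma z -> y = z.
  by move=> /U2U1 ? /U2U1 ?; exact: homeo_onto_image_inj hU1 _ _ _ _.
have injV2 y z : V2 y -> V2 z -> iter n sigma y = iter n sigma z -> y = z.
  by move=> /V2V1 ? /V2V1 ?; exact: homeo_onto_image_inj hV1 _ _ _ _.
exists (dr_Z U2 m n V2); split.
- split.
  + exact: compact_dr_Z.
  + apply: open_dr_subbase; exists U2, V2, m, n; split=> //.
    * exact: homeo_onto_image_iter.
    * exact: homeo_onto_image_iter.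
  + move=> h h' /[!inE] -[Uh Vh dh sh] [Uh' Vh' dh' sh'] rr.
    apply: dr_groupoid_eq => //; first by rewrite dh dh'.
    by apply: injV2 => //; rewrite -sh -sh' rr.
  + move=> h h' /[!inE] -[Uh Vh dh sh] [Uh' Vh' dh' sh'] ss.
    apply: dr_groupoid_eq => //; last by rewrite dh dh'.
    by apply: injU2 => //; rewrite sh sh' ss.
- by [].
- move=> h [Uh Vh dh sh]; apply: UVN; [|exact/U1U/U2U1|exact/V1V/V2V1].
  by split=> //; [exact: U2m|exact: V2n].
Qed.

End TotallyDisconnected.

Lemma dr_mem_unit x : `[< dr_mem S (x, 0 : int, x) >].
Proof. by apply/asboolP; exists 0%N, 0%N. Qed.

Definition unitg x : G := DRGroupoid (dr_mem_unit x).

Lemma lag_unit x : lag (unitg x) 0 0. Proof. by []. Qed.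

Lemma lag00P g : lag g 0 0 -> g = unitg (rng g).
Proof. by move=> [dg _ _ /= sg]; exact: dr_groupoid_eq. Qed.

Lemma unitP g : deg g = 0 -> rng g = src g -> g = unitg (rng g).
Proof. by move=> dg rs; exact: dr_groupoid_eq. Qed.

Lemma unitg_continuous : continuous unitg.
Proof.
move=> x N /(nbhs_dr_groupoid _ (lag_unit x)) [U [V [xU xV UVN]]].
rewrite /= nbhs_simpl; apply: filterS (filterI xU xV) => y [Uy Vy].
exact: UVN.
Qed.

Lemma open_unitg (V : set X) : open V -> open (unitg @` V).
Proof.
rewrite !openE => oV _ [x Vx <-]; apply/(nbhs_dr_groupoid _ (lag_unit x)).
exists V, setT; split=> //=; [exact: oV|exact: filterT|].
by move=> h /lag00P hE Vh _; exists (rng h).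
Qed.

Lemma bisection_unitg (V : set X) : compact V -> open V -> bisection (unitg @` V).
Proof.
move=> cV oV; split.
- apply: continuous_compact cV.
  exact/continuous_subspaceT/unitg_continuous.
- exact: open_unitg.
- by move=> _ _ /[!inE] -[x _ <-] [y _ <-] xy; congr unitg.
- by move=> _ _ /[!inE] -[x _ <-] [y _ <-] xy; congr unitg.
Qed.

Lemma dr_mem_inv g : `[< dr_mem S (src g, - deg g, rng g) >].
Proof.
apply/asboolP; have [m [n [dg mg ng sg]]] := lag_exists g.
by exists n, m; split=> //=; rewrite dg opprB.
Qed.

Definition invg g : G := DRGroupoid (dr_mem_inv g).

Lemma lag_add l g m n : lag g m n -> dom l (iter m sigma (rng g)) ->
  lag g (m + l) (n + l).
Proof.
move=> [dg mg ng sg] lg; split.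
- by rewrite dg; lia.
- exact/dr_iter_domD.
- by apply/dr_iter_domD; rewrite -sg.
- by rewrite -!iter_shift sg.
Qed.

(** Two composable arrows have witnesses that agree at the middle point: the
    smaller exponent there can be raised, as the middle point lies in the domain of
    the larger power of [sigma]. *)
Lemma lag_composable a b : src a = rng b ->
  exists m n q, lag a m n /\ lag b n q.
Proof.
move=> ab; have [m [n amn]] := lag_exists a; have [p [q bpq]] := lag_exists b.
have [/subnKC np|/ltnW /subnKC pn] := leqP p n.
  exists m, n, (q + (n - p))%N; split=> //.
  have : lag b (p + (n - p)) (q + (n - p)); last by rewrite np.
  apply: lag_add => //; case: amn => _ _ + _; rewrite ab -{1}np.
  by move=> /dr_iter_domD[].
exists (m + (p - n))%N, p, q; split=> //.
have : lag a (m + (p - n)) (n + (p - n)); last by rewrite pn.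
apply: lag_add => //; case: amn (bpq) => _ _ _ -> [_ + _ _].
by rewrite ab -{1}pn => /dr_iter_domD[].
Qed.

Lemma lag_comp a b g m n q : lag a m n -> lag b n q -> is_comp a b g ->
  lag g m q.
Proof.
move=> [da ma na sa] [db nb qb sb] [ab gE]; rewrite /lag /deg /rng /src gE /=.
by split=> //; [rewrite da db; lia|rewrite sa ab sb].
Qed.

Lemma is_compP a b : src a = rng b -> exists g, is_comp a b g.
Proof.
move=> ab; have [m [n [q [amn bnq]]]] := lag_composable ab.
case: amn bnq => da ma na sa [db nb qb sb].
have [|g [gE _ _ _]] := arrow_exists ma qb; first by rewrite sa ab sb.
by exists g; split=> //; rewrite gE da db; congr (_, _, _); lia.
Qed.

Lemma is_comp_rng a b g : is_comp a b g -> rng g = rng a.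
Proof. by rewrite /rng => -[_ ->]. Qed.
Lemma is_comp_src a b g : is_comp a b g -> src g = src b.
Proof. by rewrite /src => -[_ ->]. Qed.
Lemma is_comp_deg a b g : is_comp a b g -> deg g = deg a + deg b.
Proof. by rewrite /deg => -[_ ->]. Qed.

Lemma is_compI a b g : src a = rng b -> rng g = rng a -> src g = src b ->
  deg g = deg a + deg b -> is_comp a b g.
Proof.
move=> ab rg sg dg; split=> //; move: rg sg dg; rewrite /rng /src /deg.
by case: (dr_triple g) => [[? ?] ?] /= -> -> ->.
Qed.

Lemma is_comp_inj_l a a' b g : is_comp a b g -> is_comp a' b g -> a = a'.
Proof.
move=> c c'; apply: dr_groupoid_eq.
- by rewrite -(is_comp_rng c) (is_comp_rng c').
- by apply: (addIr (deg b)); rewrite -(is_comp_deg c) (is_comp_deg c').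
- by rewrite c.1 c'.1.
Qed.

Lemma is_comp_inj_r a b b' g : is_comp a b g -> is_comp a b' g -> b = b'.
Proof.
move=> c c'; apply: dr_groupoid_eq.
- by rewrite -c.1 c'.1.
- by apply: (addrI (deg a)); rewrite -(is_comp_deg c) (is_comp_deg c').
- by rewrite -(is_comp_src c) (is_comp_src c').
Qed.

Definition prod_set (U V : set G) : set G :=
  [set g | exists a b, [/\ U a, V b & is_comp a b g]].

(** Multiplication is open. Near [g = a b] a factorization is found by choosing
    the middle point in the image of a neighbourhood of [src a] under
    [iter n sigma], an open map. *)
Lemma prod_set_nbhs a b g U V : is_comp a b g -> nbhs a U -> nbhs b V ->
  nbhs g (prod_set U V).
Proof.
move=> abg; have [m [n [q [amn bnq]]]] := lag_composable abg.1.
move=> /(nbhs_dr_groupoid _ amn) [P [Q [aP aQ PQU]]].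
move=> /(nbhs_dr_groupoid _ bnq) [Q' [R [bQ' bR QRV]]].
apply/(nbhs_dr_groupoid _ (lag_comp amn bnq abg)).
have [_ ma na sa] := amn.
pose W := Q `&` Q' `&` dom n.
have aW : nbhs (src a) W.
  apply: filterI; last exact: dr_iter_dom_nbhs.
  by apply: filterI => //; rewrite abg.1.
exists (P `&` iter m sigma @^-1` (iter n sigma @` W)), R; split.
- rewrite (is_comp_rng abg); apply: filterI => //.
  by apply: (iter_continuous ma); rewrite sa; exact: iter_nbhs_image.
- by rewrite (is_comp_src abg).
- move=> h [dh mh qh sh] [Ph [y [[Qy Q'y] ny] yh]] Rh.
  have [a' [a'E ra' sa' a'mn]] := arrow_exists mh ny (esym yh).
  have [|b' [b'E rb' sb' b'nq]] := arrow_exists ny qh; first by rewrite yh.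
  exists a', b'; split.
  + by apply: PQU => //; rewrite ?ra' ?sa'.
  + by apply: QRV => //; rewrite ?rb' ?sb'.
  + apply: is_compI; rewrite ?ra' ?sb' ?sa' ?rb'//.
    by rewrite dh; case: a'mn b'nq => -> _ _ _ [-> _ _ _]; lia.
Qed.

(** The product is parametrized by the composable pairs, which form a closed
    subset of the compact set [U `*` V]. *)
Lemma compact_prod_set (U V : set G) : compact U -> compact V ->
  compact (prod_set U V).
Proof.
move=> cU cV.
have /choice [phi phiP] : forall g, exists ab : G * G, prod_set U V g ->
    [/\ U ab.1, V ab.2 & is_comp ab.1 ab.2 g].
  move=> g; have [[a [b abg]]|nUV] := pselect (prod_set U V g).
    by exists (a, b).
  by exists (g, g).
apply: (compact_transfer (phi := phi) (compact_setX cU cV)).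
  by move=> g /phiP[].
move=> [a b] [/= Ua Vb]; have [ab|ab] := pselect (src a = rng b); last first.
  left; have [A [B [aA bB AB]]] := hausdorff_near_neq (dr_hausdorff S)
    (@src_continuous a) (@rng_continuous b) ab.
  exists (A `*` B); first by exists (A, B).
  by move=> g /phiP[_ _ [gg _]] [/= Ag Bg]; exact: AB gg.
right; have [g abg] := is_compP ab; exists g; first by exists a, b.
have [m [n [q [amn bnq]]]] := lag_composable ab.
move=> N /(nbhs_dr_groupoid _ (lag_comp amn bnq abg)) [P [R [gP gR PRN]]].
exists ([set h | lag h m n /\ P (rng h)] `*` [set h | lag h n q /\ R (src h)]).
  exists ([set h | lag h m n /\ P (rng h)], [set h | lag h n q /\ R (src h)]);
    last by [].
  split=> /=.
    apply/(nbhs_dr_groupoid _ amn); exists P, setT; split=> //.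
      by rewrite -(is_comp_rng abg).
    exact: filterT.
  apply/(nbhs_dr_groupoid _ bnq); exists setT, R; split=> //.
    exact: filterT.
  by rewrite -(is_comp_src abg).
move=> h /phiP[_ _ habg] [/= [l1 Ph] [l2 Rh]]; apply: PRN.
- exact: lag_comp l1 l2 habg.
- by rewrite (is_comp_rng habg).
- by rewrite (is_comp_src habg).
Qed.

Lemma bisection_prod_set (U V : set G) : bisection U -> bisection V ->
  bisection (prod_set U V).
Proof.
move=> [cU oU rU sU] [cV oV rV sV]; split.
- exact: compact_prod_set.
- rewrite openE => g [a [b [Ua Vb abg]]].
  by apply: prod_set_nbhs abg _ _; exact: open_nbhs_nbhs.
- move=> g h /[!inE] -[a [b [Ua Vb abg]]] [a' [b' [Ua' Vb' abh]]] gh.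
  have aa' : a = a'.
    by apply: rU; rewrite ?inE// -(is_comp_rng abg) gh (is_comp_rng abh).
  have bb' : b = b' by apply: rV; rewrite ?inE// -abg.1 aa' abh.1.
  apply: dr_groupoid_eq => //.
    by rewrite (is_comp_deg abg) (is_comp_deg abh) aa' bb'.
  by rewrite (is_comp_src abg) (is_comp_src abh) bb'.
- move=> g h /[!inE] -[a [b [Ua Vb abg]]] [a' [b' [Ua' Vb' abh]]] gh.
  have bb' : b = b'.
    by apply: sV; rewrite ?inE// -(is_comp_src abg) gh (is_comp_src abh).
  have aa' : a = a' by apply: sU; rewrite ?inE// abg.1 bb' -abh.1.
  apply: dr_groupoid_eq => //.
    by rewrite (is_comp_rng abg) (is_comp_rng abh) aa'.
  by rewrite (is_comp_deg abg) (is_comp_deg abh) aa' bb'.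
Qed.

Lemma bisection_setI (B N : set G) : bisection B -> open N -> closed N ->
  bisection (B `&` N).
Proof.
move=> [cB oB rB sB] oN cN; split.
- exact: compact_closedI.
- exact: openI.
- by move=> g h /[!inE] -[? _] [? _]; apply: rB; rewrite inE.
- by move=> g h /[!inE] -[? _] [? _]; apply: sB; rewrite inE.
Qed.

End Bisections.

(** * The Steinberg algebra and its convolution *)

Section Span.
Variables (K : fieldType) (V : lmodType K).
Implicit Types (B : set V) (u v : V).

Lemma lspan_ind B (P : V -> Prop) : P 0 ->
  (forall c b v, B b -> P v -> P (c *: b + v)) -> forall v, lspan B v -> P v.
Proof.
move=> P0 PD _ [n [b [c [Bb ->]]]]; elim: n => [|n IHn] in b c Bb *.
  by rewrite big_ord0.
by rewrite big_ord_recl; apply: PD => //; apply: IHn => i.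
Qed.

Lemma lspan0 B : lspan B 0.
Proof. by exists 0%N, (fun=> 0), (fun=> 0); split=> [[]|]//; rewrite big_ord0. Qed.

Lemma lspan_cons B c b v : B b -> lspan B v -> lspan B (c *: b + v).
Proof.
move=> Bb [n [b' [c' [Bb' ->]]]].
exists n.+1, (fun i => oapp b' b (unlift ord0 i)).
exists (fun i => oapp c' c (unlift ord0 i)); split.
  by move=> i; case: (unlift _ _) => [j|] /=.
rewrite big_ord_recl unlift_none /=; congr (_ + _).
by apply: eq_bigr => i _; rewrite liftK.
Qed.

Lemma lspan_linear B c u v : lspan B u -> lspan B v -> lspan B (c *: u + v).
Proof.
move=> + Bv; elim/lspan_ind : u / => [|d b w Bb IH].
  by rewrite scaler0 add0r.
by rewrite scalerDr -addrA scalerA; exact: lspan_cons.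
Qed.

Lemma lspan_gen B b : B b -> lspan B b.
Proof.
by move=> Bb; rewrite -[b]addr0 -[b]scale1r; apply: lspan_cons => //; exact: lspan0.
Qed.

End Span.

Lemma finite_set_subset1 (T : choiceType) (A : set T) :
  (forall x y, A x -> A y -> x = y) -> finite_set A.
Proof.
move=> A1; have [[x Ax]|nA] := pselect (exists x, A x).
  by apply: (@sub_finite_set _ _ [set x]) => [y Ay|]; [exact: A1|exact: finite_set1].
apply: (@sub_finite_set _ _ set0) => // y Ay; by case: nA; exists y.
Qed.

Section Convolution.
Variables (K : fieldType) (X : topologicalType) (S : dr_system X).
Local Notation G := (dr_groupoid S).
Local Notation bisection := (@compact_open_bisection X S).
Local Notation A := (@steinberg K X S).
Local Notation "f ** h" := (@conv K X S f h) (at level 40).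
Implicit Types (f h : G -> K^o) (g : G) (U : set G) (V : set X).

Lemma indic1 U g : U g -> (\1_U g : K^o) = 1.
Proof. by move=> Ug; rewrite indicE mem_set. Qed.

Lemma indic0 U g : ~ U g -> (\1_U g : K^o) = 0.
Proof. by move=> Ug; rewrite indicE memNset. Qed.

Lemma indic_neq0 U g : (\1_U g : K^o) != 0 -> U g.
Proof.
by move=> Ug; apply: contrapT => /indic0 Ug0; move: Ug; rewrite Ug0 eqxx.
Qed.

Lemma lin_neq0 c f h g : (c *: f + h) g != 0 -> f g != 0 \/ h g != 0.
Proof.
move=> fh; have [f0|f0] := eqVneq (f g) 0; last by left.
right; apply: contra_neq fh => h0.
by rewrite -[LHS]/(c * f g + h g) f0 h0 mulr0 addr0.
Qed.

Lemma conv_fin f h g (D : set (G * G)) : finite_set D ->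
  D `<=` [set p | is_comp p.1 p.2 g] ->
  (forall p, is_comp p.1 p.2 g -> ~ D p -> f p.1 * h p.2 = 0) ->
  (f ** h) g = \sum_(p \in D) (f p.1 * h p.2).
Proof.
move=> finD Dg D0; rewrite /conv; apply/esym/fsbig_widen => // p [pg nDp].
exact: D0.
Qed.

Lemma conv_single f h g a b : is_comp a b g ->
  (forall a' b', is_comp a' b' g -> f a' != 0 -> h b' != 0 -> a' = a) ->
  (f ** h) g = f a * h b.
Proof.
move=> abg uniq; rewrite (@conv_fin _ _ _ [set (a, b)]).
- by rewrite fsbig_set1.
- exact: finite_set1.
- by move=> _ ->.
- move=> [a' b'] /= a'b'g ne; apply/eqP; rewrite mulf_eq0.
  apply: contra_notT ne; rewrite negb_or => /andP[fa hb].
  have aa' := uniq _ _ a'b'g fa hb; rewrite aa'; congr pair.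
  by move: a'b'g; rewrite aa' => /is_comp_inj_r; apply.
Qed.

Lemma conv_eq0 f h g :
  (forall a b, is_comp a b g -> f a * h b = 0) -> (f ** h) g = 0.
Proof. by move=> fh0; rewrite /conv fsbig1// => -[a b]; exact: fh0. Qed.

Lemma conv_neq0 f h g : (f ** h) g != 0 ->
  exists a b, [/\ is_comp a b g, f a != 0 & h b != 0].
Proof.
apply: contra_neqP => nex; apply: conv_eq0 => a b abg; apply/eqP.
rewrite mulf_eq0; apply: contra_notT nex; rewrite negb_or => /andP[fa hb].
by exists a, b.
Qed.

(** Convolution by the indicator of a set of units restricts a function to
    arrows with range (or source) in that set; this holds for all functions, as
    each arrow has only one factorization through a unit. *)
Lemma conv_unitl V f g : (\1_(@unitg X S @` V) ** f) g = \1_V (rng g) * f g.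
Proof.
have ug : is_comp (unitg S (rng g)) g g.
  by apply: is_compI => //; rewrite /deg/= add0r.
rewrite (conv_single ug); first congr (_ * _).
  have [Vg|nVg] := pselect (V (rng g)).
    by rewrite !indicE !mem_set//; exists (rng g).
  rewrite !indicE !memNset// => -[x Vx /(congr1 (@rng X S)) xg]; apply: nVg.
  by move: Vx; rewrite -[x]/(rng (unitg S x)) xg.
move=> a b abg /indic_neq0 [x Vx xa] _; rewrite -xa; congr unitg.
by rewrite (is_comp_rng abg) -xa.
Qed.

Lemma conv_unitr V f g : (f ** \1_(@unitg X S @` V)) g = f g * \1_V (src g).
Proof.
have ug : is_comp g (unitg S (src g)) g.
  by apply: is_compI => //; rewrite /deg/= addr0.
rewrite (conv_single ug); first congr (_ * _).
  have [Vg|nVg] := pselect (V (src g)).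
    by rewrite !indicE !mem_set//; exists (src g).
  rewrite !indicE !memNset// => -[x Vx /(congr1 (@rng X S)) xg]; apply: nVg.
  by move: Vx; rewrite -[x]/(rng (unitg S x)) xg.
move=> a b abg _ /indic_neq0 [x Vx xb].
have xg : b = unitg S (src g) by rewrite (is_comp_src abg) -xb.
by rewrite xg in abg; exact: is_comp_inj_l abg ug.
Qed.

(** When the left factor has this property, each value of a convolution product
    is a finite sum, since the left factor of a factorization determines the right
    one; bilinearity rests on this. *)
Definition fibre_finite f := forall x, finite_set [set g | rng g = x /\ f g != 0].

Lemma fibre_finite_indic U : bisection U -> fibre_finite \1_U.
Proof.
move=> [_ _ rU _] x; apply: finite_set_subset1 => g h [gx Ug] [hx Uh].
by apply: rU; rewrite ?inE ?gx ?hx//; exact: indic_neq0.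
Qed.

Lemma fibre_finite_lin c f h : fibre_finite f -> fibre_finite h ->
  fibre_finite (c *: f + h).
Proof.
move=> ff fh x; move: (ff x) (fh x) => {}ff {}fh.
have fu : finite_set ([set g | rng g = x /\ f g != 0] `|`
                      [set g | rng g = x /\ h g != 0]).
  by rewrite finite_setU.
apply: sub_finite_set fu => g [gx /lin_neq0 []]; first by left.
by right.
Qed.

Lemma finite_factorizations f g : fibre_finite f ->
  finite_set [set p : G * G | is_comp p.1 p.2 g /\ f p.1 != 0].
Proof.
move=> /(_ (rng g)) ff.
have /choice [psi psiP] : forall a, exists b, forall b', is_comp a b' g -> b' = b.
  move=> a; have [[b abg]|nb] := pselect (exists b, is_comp a b g).
    by exists b => b' /is_comp_inj_r; apply.
  by exists a => b' abg; case: nb; exists b'.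
apply: sub_finite_set (finite_image (fun a => (a, psi a)) ff) => -[a b] /= [abg fa].
exists a; first by rewrite (is_comp_rng abg).
by rewrite (psiP _ _ abg).
Qed.

Lemma conv_linear_l c f f' h : fibre_finite f -> fibre_finite f' ->
  (c *: f + f') ** h = c *: (f ** h) + f' ** h.
Proof.
move=> ff ff'; apply/funext => g.
(* one finite index set that serves all three convolution sums *)
pose D := [set p : G * G | is_comp p.1 p.2 g /\ f p.1 != 0] `|`
          [set p : G * G | is_comp p.1 p.2 g /\ f' p.1 != 0].
have finD : finite_set D by rewrite finite_setU; split; exact: finite_factorizations.
have Dg : D `<=` [set p | is_comp p.1 p.2 g] by move=> p [[]|[]].
rewrite -[RHS]/(c * (f ** h) g + (f' ** h) g).
rewrite !(conv_fin finD) // => [|p pg nDp|p pg nDp|p pg nDp].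
- rewrite fsbig_distrr //= -fsbig_split //=; apply: eq_fsbigr => p _.
  by rewrite -[(c *: f + f') p.1]/(c * f p.1 + f' p.1) mulrDl mulrA.
- have [->|fp] := eqVneq (f' p.1) 0; first by rewrite mul0r.
  by case: nDp; right.
- have [->|fp] := eqVneq (f p.1) 0; first by rewrite mul0r.
  by case: nDp; left.
- have [e|/lin_neq0 fp] := eqVneq ((c *: f + f') p.1) 0; first by rewrite e mul0r.
  by case: nDp; case: fp; [left|right].
Qed.

Lemma conv_linear_r c f h h' : fibre_finite f ->
  f ** (c *: h + h') = c *: (f ** h) + f ** h'.
Proof.
move=> ff; apply/funext => g; have finD := finite_factorizations g ff.
set D := (X in finite_set X) in finD.
have Dg : D `<=` [set p | is_comp p.1 p.2 g] by move=> p [].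
have D0 p (k : G -> K^o) : is_comp p.1 p.2 g -> ~ D p -> f p.1 * k p.2 = 0.
  move=> pg nDp; have [->|fp] := eqVneq (f p.1) 0; first by rewrite mul0r.
  by case: nDp.
rewrite -[RHS]/(c * (f ** h) g + (f ** h') g).
rewrite !(conv_fin finD Dg (fun p => D0 p _)).
rewrite fsbig_distrr //= -fsbig_split //=; apply: eq_fsbigr => p _.
by rewrite -[(c *: h + h') p.2]/(c * h p.2 + h' p.2) mulrDr mulrCA.
Qed.

Lemma conv0 f : f ** 0 = 0.
Proof. by apply/funext => g; apply: conv_eq0 => a b _; rewrite mulr0. Qed.

Lemma conv0l f : 0 ** f = 0.
Proof. by apply/funext => g; apply: conv_eq0 => a b _; rewrite mul0r. Qed.

Lemma steinberg_indic U : bisection U -> A \1_U.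
Proof. by move=> bU; apply: lspan_gen; exists U. Qed.

(** By bilinearity this reduces to products of indicators, hence to the fact
    that compact open bisections are closed under products. *)
Lemma steinberg_conv f h : A f -> A h -> A (f ** h).
Proof.
move=> Af Ah.
suff [] : A (f ** h) /\ fibre_finite f by [].
elim/lspan_ind : Af => [|c _ f' [U bU <-] [Af' ff']].
  rewrite conv0l; split; first exact: lspan0.
  by move=> x; apply: finite_set_subset1 => g k [_]; rewrite eqxx.
have fU := fibre_finite_indic bU.
split; last exact: fibre_finite_lin.
rewrite conv_linear_l //; apply: lspan_linear => //.
elim/lspan_ind : Ah {Af'} => [|d _ h' [V bV <-] Ah'].
  by rewrite conv0; exact: lspan0.
rewrite conv_linear_r //; apply: lspan_linear => //.
by rewrite conv_indic //; exact/steinberg_indic/bisection_prod_set.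
Qed.

Lemma steinberg_locally_constant f g : A f -> \forall h \near g, f h = f g.
Proof.
elim/lspan_ind => [|c _ h [U [cU oU _ _] <-] hc].
  exact: (@nearW _ (nbhs g)).
have Uc : \forall k \near g, (\1_U k : K^o) = \1_U g.
  have [Ug|nUg] := pselect (U g).
    apply: filterS (open_nbhs_nbhs (conj oU Ug)) => k Uk.
    by rewrite !indic1.
  have cloU : open (~` U).
    apply/closed_openC/(compact_closed _ cU).
    exact: dr_groupoid_hausdorff.
  by apply: filterS (open_nbhs_nbhs (conj cloU nUg)) => k Uk; rewrite !indic0.
apply: filterS (filterI hc Uc) => k [hk Uk].
by rewrite -[LHS]/(c * \1_U k + h k) hk Uk.
Qed.

Lemma steinberg_compact_support f : A f ->
  exists2 C, compact C & forall g, f g != 0 -> C g.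
Proof.
elim/lspan_ind => [|c _ h [U [cU oU _ _] <-] [C cC hC]].
  by exists set0; [exact: compact0|move=> g; rewrite eqxx].
exists (U `|` C); first exact: compactU.
by move=> g /lin_neq0 [/indic_neq0|/hC]; [left|right].
Qed.

Lemma steinberg_deg_sub k f : steinberg_deg k f -> A f.
Proof.
elim/lspan_ind => [|c _ h [U [bU _] <-] Ah]; first exact: lspan0.
by apply: lspan_linear => //; exact: steinberg_indic.
Qed.

Lemma steinberg_deg_support k f g : steinberg_deg k f -> f g != 0 -> deg g = k.
Proof.
elim/lspan_ind => [|c _ h [U [bU Uk] <-] hk]; first by rewrite eqxx.
by move=> /lin_neq0[/indic_neq0/Uk|/hk].
Qed.

Definition homogeneous_part (k : int) f : G -> K^o :=
  fun g => if deg g == k then f g else 0.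

(** The degree is locally constant, so cutting a compact open bisection along a
    degree leaves a compact open bisection. *)
Lemma steinberg_homogeneous_part k f : A f -> steinberg_deg k (homogeneous_part k f).
Proof.
elim/lspan_ind => [|c _ h [U bU <-] hk].
  suff -> : homogeneous_part k 0 = 0 by exact: lspan0.
  by apply/funext => g; rewrite /homogeneous_part; case: ifP.
have -> : homogeneous_part k (c *: \1_U + h) =
    c *: \1_(U `&` [set g | deg g = k]) + homogeneous_part k h.
  apply/funext => g; rewrite /homogeneous_part.
  rewrite -[RHS]/(c * \1_(U `&` [set g | deg g = k]) g +
                 (if deg g == k then h g else 0)).
  have [dg|dg] := eqVneq (deg g) k; last first.
    by rewrite indic0 ?mulr0 ?addr0// => -[_ /= /eqP]; rewrite (negbTE dg).
  rewrite -[LHS]/(c * \1_U g + h g); congr (_ * _ + _).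
  by have [Ug|nUg] := pselect (U g); [rewrite !indic1//|rewrite !indic0// => -[]].
apply: lspan_cons => //; exists (U `&` [set g | deg g = k]) => //; split.
  by apply: bisection_setI => //; [exact: open_deg|exact: closed_deg].
by move=> g [].
Qed.

(** A compact set of arrows meets finitely many degrees, again because the
    degree is locally constant. Compactness is used for the cofinite filter on the
    integers. *)
Lemma finite_degrees f : A f -> finite_set [set k | homogeneous_part k f != 0].
Proof.
move=> Af; have [C cC fC] := steinberg_compact_support Af.
have fin : finite_set (@deg X S @` C).
  pose cofinite : set_system int := [set D : set int | finite_set (~` D)].
  have FF : Filter cofinite.
    split=> [|D D' fD fD'|D D' DD' fD].
    - by rewrite /cofinite /= setCT.
    - by rewrite /cofinite /= setCI finite_setU.
    - by apply: sub_finite_set fD; exact: subsetC.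
  have /compact_near_coveringP cov := cC.
  have := cov _ _ (fun k g => deg g <> k) FF.
  have near_k g : C g -> \forall h \near g & k \near cofinite, deg h <> k.
    move=> _; exists ([set h | deg h = deg g], [set k | k <> deg g]).
      split; first exact: deg_locally_constant.
      by apply: sub_finite_set (finite_set1 (deg g)) => k /contrapT.
    by move=> [h k] [/= -> ?] /esym.
  move=> /(_ near_k) finC; apply: sub_finite_set finC => _ [g Cg <-] /(_ _ Cg).
  by apply.
apply: sub_finite_set fin => k /eqP fk.
have [g fg] : exists g, homogeneous_part k f g != 0.
  apply: contrapT => nex; apply: fk; apply/funext => g; apply/eqP.
  by apply: contra_notT nex => ?; exists g.
move: fg; rewrite /homogeneous_part.
have [dg fg|_] := eqVneq (deg g) k; last by rewrite eqxx.
by exists g => //; exact: fC.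
Qed.

End Convolution.

(** * The graded ideal of a closed invariant set *)

Section Invariant.
Variables (X : topologicalType) (S : dr_system X) (W : set X).
Local Notation sigma := (dr_map S).
Local Notation dom := (dr_iter_dom S).
Hypothesis invW : dr_invariant S W.

Lemma invariant_iter m x : dom m x -> W (iter m sigma x) <-> W x.
Proof.
elim: m => [//|m IHm] /= [mx Dx]; rewrite -IHm //; split=> Wx.
  by apply: invW.2.
by apply: invW.1; exists (iter m sigma x).
Qed.

Lemma invariant_arrow (g : dr_groupoid S) : W (rng g) <-> W (src g).
Proof.
have [m [n [_ mg ng sg]]] := lag_exists g.
by rewrite -(invariant_iter mg) sg (invariant_iter ng).
Qed.

Lemma restr_iter_domP m x : dr_restr_iter_dom S W m x <-> W x /\ dom m x.
Proof.
rewrite /dr_restr_iter_dom; elim: m => [|m IHm] /=; first by split=> [|[]].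
split=> [[/IHm[Wx mx] [_ Dx]]|[Wx [mx Dx]]]; split=> //.
  by apply/IHm.
by split=> //; apply/invariant_iter.
Qed.

End Invariant.

Section VanishingIdeal.
Variables (K : fieldType) (X : topologicalType) (S : dr_system X).
Local Notation G := (dr_groupoid S).
Local Notation A := (@steinberg K X S).
Implicit Types (f h : G -> K^o) (g : G) (W : set X).

Lemma fsbig_homogeneous (v : int -> G -> K^o) g :
  finite_set [set k | v k != 0] ->
  (forall k g, v k g != 0 -> deg g = k) ->
  (\sum_(k \in setT) v k) g = v (deg g) g.
Proof.
move=> finv vdeg.
(* [deg g] is added so that the only possibly nonzero term is indexed *)
pose D := [set k | v k != 0] `|` [set deg g].
have finD : finite_set D by rewrite finite_setU; split=> //; exact: finite_set1.
have -> : \sum_(k \in setT) v k = \sum_(k \in D) v k.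
  apply/esym/fsbig_widen => // k [_ nDk] /=; apply/eqP.
  by apply: contra_notT nDk; left.
transitivity (\sum_(k \in D) v k g).
  rewrite !fsbig_finite //; exact: (big_morph (fun f : G -> K^o => f g)).
transitivity (\sum_(k \in [set deg g]) v k g); last by rewrite fsbig_set1.
apply/esym/fsbig_widen => [_ ->|k [_ kg]]; first by right.
by apply/eqP; apply: contra_notT kg => /= /vdeg.
Qed.

(** The kernel of the restriction to the reduction of the groupoid to [W]; as
    [W] is invariant, arrows over [W] are those with range in [W]. *)
Definition vanishing W : set (G -> K^o) :=
  [set f | A f /\ forall g, W (rng g) -> f g = 0].

Lemma vanishing_homogeneous_part W k f :
  vanishing W f -> vanishing W (homogeneous_part k f).
Proof.
move=> [Af fW]; split.
  exact/steinberg_deg_sub/steinberg_homogeneous_part.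
by move=> g /fW fg; rewrite /homogeneous_part fg; case: ifP.
Qed.

Lemma vanishing_graded_ideal W : dr_invariant S W ->
  graded_ideal (@conv K X S) A (@steinberg_deg K X S) (vanishing W).
Proof.
move=> invW.
have linJ : linear_subspace (vanishing W).
  split=> [|c u v [Au uW] [Av vW]]; first by split=> //; exact: lspan0.
  split; first exact: lspan_linear.
  move=> g Wg; rewrite -[LHS]/(c * u g + v g) uW// vW//.
  by rewrite mulr0 addr0.
split.
  split=> // [f []//|a x Aa [Ax xW]]; split; split; try exact: steinberg_conv.
    move=> g Wg; apply: conv_eq0 => b c bcg; rewrite (xW c) ?mulr0//.
    by apply/(invariant_arrow invW); rewrite -(is_comp_src bcg); apply/invariant_arrow.
  move=> g Wg; apply: conv_eq0 => b c bcg; rewrite (xW b) ?mul0r//.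
  by rewrite -(is_comp_rng bcg).
have ddeg (v : int -> G -> K^o) :
    fin_supp_family (fun k => steinberg_deg k `&` vanishing W) v ->
    forall k g, v k g != 0 -> deg g = k.
  by move=> [vJ _] k g; apply: steinberg_deg_support; have [] := vJ k.
split.
  apply/seteqP; split=> [f Jf|_ [v vF <-]].
    exists (fun k => homogeneous_part k f).
      split; last by apply: finite_degrees; case: Jf.
      move=> k; split; last exact: vanishing_homogeneous_part.
      by apply: steinberg_homogeneous_part; case: Jf.
    apply/funext => g; rewrite fsbig_homogeneous.
    - by rewrite /homogeneous_part eqxx.
    - by apply: finite_degrees; case: Jf.
    - move=> k h; rewrite /homogeneous_part.
      by have [//|_] := eqVneq (deg h) k; rewrite eqxx.
  have finv := vF.2; have vJ := vF.1.
  have -> : \sum_(k \in setT) v k = \sum_(k \in [set k | v k != 0]) v k.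
    apply/esym/fsbig_widen => // k [_ /= vk]; apply/eqP.
    by apply: contra_notT vk.
  rewrite fsbig_finite //; elim/big_ind: _ => [|a b Ja Jb|k _].
  - exact: linJ.1.
  - by rewrite -[a]scale1r; exact: linJ.2.
  - exact: (vJ k).2.
move=> v w vF wF vw; apply/funext => k; apply/funext => g.
have [dg|dg] := eqVneq (deg g) k.
  rewrite -dg -(fsbig_homogeneous _ vF.2 (ddeg _ vF)) vw.
  by rewrite (fsbig_homogeneous _ wF.2 (ddeg _ wF)).
have vanish u : fin_supp_family (fun k => steinberg_deg k `&` vanishing W) u ->
    u k g = 0.
  by move=> uF; apply/eqP; apply: contraNT dg => /(ddeg _ uF)/eqP.
by rewrite !vanish.
Qed.

Hypothesis hX : totally_disconnected [set: X].

Lemma separating_bisection (D : {fset G}) g : exists B,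
  [/\ compact_open_bisection B, B g & forall a, a \in D -> a != g -> ~ B a].
Proof.
have clD : closed [set` (D `\ g)%fset].
  have /accessible_finite_set_closed : @accessible_space G.
    exact/hausdorff_accessible/dr_groupoid_hausdorff.
  by apply; exact: finite_fset.
have gD : nbhs g (~` [set` (D `\ g)%fset]).
  apply: open_nbhs_nbhs; split; first exact: closed_openC.
  by rewrite /= !inE eqxx.
have [B [bB Bg BD]] := bisection_base hX gD.
by exists B; split=> // a aD ag /BD; rewrite /= !inE ag aD.
Qed.

(** Bisections that isolate each of [n] arrows over [W] show that the functions
    on these arrows form a quotient of [A / vanishing W]; so [n] is at most the
    size of a spanning set of that quotient, by comparison of the rank of the
    identity matrix with the number of rows of the matrix of values. *)
Lemma finite_reduction W : finite_dim_quotient A (vanishing W) ->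
  finite_set [set g : G | W (rng g)].
Proof.
move=> [B [/finite_seqP[bs ->] BA Bspan]]; apply: contrapT => infW.
have [D DW sD] := infinite_set_fset (size bs).+1 infW.
pose n := size (enum_fset D).
have [g0 _] : exists g0, g0 \in D.
  by apply/fset0Pn; rewrite -cardfs_gt0; exact: leq_trans sD.
pose gs (j : 'I_n) := nth g0 (enum_fset D) j.
have gsD j : gs j \in D by apply: mem_nth.
pose M : 'M[K]_(size bs, n) := \matrix_(l, j) (nth 0 bs l) (gs j).
have spanM b : lspan [set` bs] b -> ((\row_j (b (gs j) : K)) <= M)%MS.
  elim/lspan_ind => [|c a v /= abs vM].
    by rewrite (_ : \row_j _ = 0) ?sub0mx//; apply/rowP => j; rewrite !mxE.
  have -> : \row_j ((c *: a + v) (gs j) : K) =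
      c *: (\row_j (a (gs j) : K)) + (\row_j (v (gs j) : K)).
    by apply/rowP => j; rewrite !mxE.
  apply: addmx_sub => //; apply: scalemx_sub.
  have al : (index a bs < size bs)%N by rewrite index_mem.
  have -> : \row_j (a (gs j) : K) = row (Ordinal al) M.
    by apply/rowP => j; rewrite !mxE /= nth_index.
  exact: row_sub.
(* it remains to see that the rows of [M] span all of ['rV_n] *)
suff : (n <= size bs)%N.
  by move: sD; rewrite /n /= => /leq_trans /[apply]; rewrite ltnn.
rewrite -(mxrank1 K n) (leq_trans _ (rank_leq_row M))// mxrankS//.
apply/row_subP => i; have [N [bN Ni ND]] := separating_bisection D (gs i).
have [b Bb [_ bW]] := Bspan _ (steinberg_indic K bN).
suff -> : row i 1%:M = \row_j (b (gs j) : K) by exact: spanM.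
apply/rowP => j; rewrite !mxE.
have /eqP := bW (gs j) (DW _ (gsD j)).
rewrite -[X in X == _]/(\1_N (gs j) - b (gs j)) subr_eq0 => /eqP <-.
have [<-|ij] := eqVneq i j; first by rewrite indic1.
rewrite indic0//; apply: ND => //; rewrite nth_uniq// 1?eq_sym//.
Qed.

(** The vanishing ideal is nonzero because [W] is not the whole space: it holds
    the indicator of a compact open set of units outside [W]. *)
Lemma just_infinite_restriction W : closed W -> W <> setT -> dr_invariant S W ->
  graded_just_infinite (@conv K X S) A (@steinberg_deg K X S) ->
  finite_set [set g : G | W (rng g)].
Proof.
move=> clW WT invW [_ ji]; apply/finite_reduction/ji.
  exact: vanishing_graded_ideal.
have [x nWx] : exists x, ~ W x.
  by apply: contra_notP WT => /forallNP nW; apply/seteqP; split=> // x _;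
     apply: contrapT; exact: nW.
have [V [cV oV Vx VW]] := compact_open_base (dr_hausdorff S)
  (dr_locally_compact S) hX (open_nbhs_nbhs (conj (closed_openC clW) nWx)).
have bV := bisection_unitg S cV oV.
move=> J0; have : vanishing W (\1_(unitg S @` V) : G -> K^o).
  split; first exact: steinberg_indic.
  by move=> g Wg; apply: indic0 => -[y Vy yg]; apply: (VW _ Vy); rewrite -yg in Wg.
rewrite J0 => /(congr1 (fun f : G -> K^o => f (unitg S x))) /eqP.
by rewrite indic1 ?oner_eq0//; exists x.
Qed.

End VanishingIdeal.

Section Cycles.
Variables (X : topologicalType) (S : dr_system X) (W : set X).
Local Notation G := (dr_groupoid S).
Local Notation sigma := (dr_map S).
Local Notation dom := (dr_iter_dom S).
Hypothesis invW : dr_invariant S W.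

Lemma finite_reduction_unit_space : finite_set [set g : G | W (rng g)] -> finite_set W.
Proof.
move=> finG; apply: sub_finite_set (finite_image (@rng X S) finG) => x Wx.
by exists (unitg S x).
Qed.

(** A periodic point carries isotropy arrows of every degree that is a multiple
    of the period, so infinitely many arrows. *)
Lemma finite_reduction_acyclic p y : (0 < p)%N ->
  finite_set [set g : G | W (rng g)] -> W y -> dom p y -> iter p sigma y <> y.
Proof.
move=> p0 finG Wy py yy.
have cyc k : dom (k * p) y /\ iter (k * p) sigma y = y.
  elim: k => [|k [ky IHk]]; first by [].
  rewrite mulSn addnC; split; first by apply/dr_iter_domD; rewrite IHk.
  by rewrite -iter_shift IHk.
have : finite_set ((fun k => (k * p)%:Z) @^-1` (@deg X S @` [set g : G | W (rng g)])).
  apply: finite_preimage; last exact: finite_image.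
  by move=> i j _ _ [] /eqP; rewrite eqn_pmul2r// => /eqP.
rewrite (_ : _ @^-1` _ = setT); first exact: infinite_nat.
apply/seteqP; split=> // k _; have [ky kyy] := cyc k.
have [g [gE rg _ _]] := @arrow_exists _ S y _ 0 y ky I kyy.
by exists g; rewrite /= ?rg// /deg gE /= subr0.
Qed.

(** An orbit of length [#|W|] inside [W] lists more than [#|W|] points, so it
    runs into a cycle. *)
Lemma finite_reduction_no_long_path : finite_set [set g : G | W (rng g)] ->
  dr_restr_iter_dom S W #|` fset_set W| = set0.
Proof.
move=> finG; have finW := finite_reduction_unit_space finG.
rewrite -subset0 => x /(restr_iter_domP invW) [Wx nx].
set n := #|` fset_set W| in nx.
have dx i : (i <= n)%N -> dom i x by move=> ?; exact: dr_iter_dom_le nx.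
(* the first [n.+1] points of the orbit, all in [W] *)
pose s := mkseq (fun i => iter i sigma x) n.+1.
have [us|nus] := boolP (uniq s).
  have : (size s <= n)%N.
    apply: uniq_leq_size => // y /mapP[i]; rewrite mem_iota add0n ltnS => ii ->.
    rewrite in_fset_set// inE; apply/(invariant_iter invW) => //; exact: dx.
  by rewrite size_mkseq ltnn.
have /(uniqPn x)[i [j [ij]]] := nus; rewrite size_mkseq => jn.
rewrite !nth_mkseq//; last exact: ltn_trans jn.
have jE : j = (i + (j - i))%N by rewrite subnKC// ltnW.
have [iD jD] : dom i x /\ dom (j - i) (iter i sigma x).
  by apply/dr_iter_domD; rewrite -jE; exact: dx.
rewrite [in RHS]jE -iter_shift => /esym.
apply: finite_reduction_acyclic => //; first by rewrite subn_gt0.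
exact/(invariant_iter invW).
Qed.

End Cycles.

(** * The open invariant set of a graded ideal *)

Section IdealSupport.
Variables (K : fieldType) (X : topologicalType) (S : dr_system X).
Local Notation G := (dr_groupoid S).
Local Notation A := (@steinberg K X S).
Local Notation sigma := (dr_map S).
Local Notation "f ** h" := (@conv K X S f h) (at level 40).
Local Notation idem V := (\1_(@unitg X S @` V) : G -> K^o).
Implicit Types (f h : G -> K^o) (g : G) (V : set X).

Hypothesis hX : totally_disconnected [set: X].
Variable J : set (G -> K^o).
Hypothesis idealJ : is_ideal (@conv K X S) A J.

(** The open set of units attached to an ideal; the ideal contains every
    function of the algebra that is supported over it ([ideal_vanishing]). *)
Definition ideal_support : set X :=
  [set x | exists V, [/\ compact V, open V, V x & J (idem V)]].

Lemma idealZ c f : J f -> J (c *: f).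
Proof.
by case: idealJ => -[J0 JD] _ _ Jf; rewrite -[c *: f]addr0; exact: JD.
Qed.

Lemma idealD f h : J f -> J h -> J (f + h).
Proof.
by case: idealJ => -[J0 JD] _ _ Jf Jh; rewrite -[f]scale1r; exact: JD.
Qed.

Lemma ideal_steinberg f : J f -> A f. Proof. by case: idealJ => _ + _; apply. Qed.

Lemma ideal_convl f h : A f -> J h -> J (f ** h).
Proof. by case: idealJ => _ _ JM Af Jh; have [] := JM _ _ Af Jh. Qed.

Lemma ideal_convr f h : J f -> A h -> J (f ** h).
Proof. by case: idealJ => _ _ JM Jf Ah; have [] := JM _ _ Ah Jf. Qed.

(** Degree zero arrows are determined by range and source, so the only one from
    [x] to [x] is the unit; by compactness of the support, near [x] in both range
    and source the support of [f] consists of units. *)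
Lemma near_unit f (x : X) : A f -> (forall g, f g != 0 -> deg g = 0) ->
  exists2 U : set X, nbhs x U & forall g, f g != 0 -> U (rng g) -> U (src g) ->
    g = unitg S (rng g).
Proof.
move=> Af f0; have [C /compact_near_coveringP cov fC] := steinberg_compact_support Af.
pose P (yz : X * X) g := f g != 0 -> rng g = yz.1 -> src g = yz.2 ->
  g = unitg S (rng g).
have [] := cov _ _ P (filter_prod_filter (nbhs_filter x) (nbhs_filter x)).
  move=> g _; have [fg0|fg] := eqVneq (f g) 0.
    exists ([set h | f h = f g], setT).
      by split; [exact: steinberg_locally_constant|exact: filterT].
    by move=> [h yz] [/= fh _]; rewrite /P fh fg0 eqxx.
  have [rg|rg] := pselect (rng g = x); last first.
    have [U [V [gU xV UV]]] := hausdorff_near_neq (dr_hausdorff S)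
      (@rng_continuous _ S g) (@cvg_id _ (nbhs x)) rg.
    exists (U, V `*` setT).
      by split=> //; exists (V, setT) => //; split=> //; exact: filterT.
    by move=> [h [y z]] [/= Uh [/= Vy _]] _ /= /(UV _ _ Uh Vy).
  have [sg|sg] := pselect (src g = x); last first.
    have [U [V [gU xV UV]]] := hausdorff_near_neq (dr_hausdorff S)
      (@src_continuous _ S g) (@cvg_id _ (nbhs x)) sg.
    exists (U, setT `*` V).
      by split=> //; exists (setT, V) => //; split=> //; exact: filterT.
    by move=> [h [y z]] [/= Uh [/= _ Vz]] _ /= _ /(UV _ _ Uh Vz).
  exists (unitg S @` setT, setT); last by move=> [h yz] [/= [y _ <-] _].
  split; last exact: filterT.
  apply: open_nbhs_nbhs; split; first exact/open_unitg/openT.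
  by exists (rng g) => //; apply/esym/unitP; [exact: f0|rewrite rg sg].
move=> [U V] [/= xU xV] UVP; exists (U `&` V); first exact: filterI.
move=> g fg [Ug _] [_ Vg]; apply: (UVP (rng g, src g)) => //.
exact: fC.
Qed.

(** Cutting [f] on both sides by a small compact open set [V] around [x] leaves
    a nonzero multiple of the indicator of [V]. *)
Lemma ideal_support_unit f (x : X) : J f -> (forall g, f g != 0 -> deg g = 0) ->
  f (unitg S x) != 0 -> ideal_support x.
Proof.
move=> Jf f0 fx; have Af := ideal_steinberg Jf.
have [U xU Uunit] := near_unit x Af f0.
have cx : \forall y \near x, f (unitg S y) = f (unitg S x).
  exact: unitg_continuous (steinberg_locally_constant (unitg S x) Af).
have [V [cV oV Vx VU]] := compact_open_base (dr_hausdorff S)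
  (dr_locally_compact S) hX (filterI xU cx).
exists V; split=> //.
have AV : A (idem V) by exact/steinberg_indic/bisection_unitg.
suff <- : (f (unitg S x))^-1 *: (idem V ** f ** idem V) = idem V.
  exact/idealZ/ideal_convr/AV/ideal_convl.
apply/funext => g; rewrite -[LHS]/(_ * (idem V ** f ** idem V) g).
rewrite conv_unitr conv_unitl.
have [fg|fg] := eqVneq (f g) 0.
  rewrite fg mulr0 mul0r mulr0 indic0// => -[y Vy yg].
  by move: fx; have [_ <-] := VU _ Vy; rewrite yg fg eqxx.
have [Vr|nVr] := pselect (V (rng g)); last first.
  rewrite [\1_V (rng g)]indicE memNset// mul0r mul0r mulr0 indic0// => -[y Vy yg].
  by apply: nVr; rewrite -yg.
have [Vs|nVs] := pselect (V (src g)); last first.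
  rewrite [\1_V (src g)]indicE memNset// !mulr0 indic0// => -[y Vy yg].
  by apply: nVs; rewrite -yg.
have gE := Uunit _ fg (VU _ Vr).1 (VU _ Vs).1.
rewrite indic1; last by exists (rng g).
rewrite ![\1_V _]indicE !mem_set// mul1r mulr1.
have [_ e] := VU _ Vr; rewrite gE e mulVf//.
Qed.

(** This is where the grading matters: right multiplication by the indicator of a
    bisection through the inverse of [g], inside degree [-k], moves a homogeneous
    element of degree [k] into degree zero and its value at [g] to the unit at
    [rng g]. *)
Lemma ideal_support_homogeneous k f g : J f ->
  (forall a, f a != 0 -> deg a = k) -> f g != 0 -> ideal_support (rng g).
Proof.
move=> Jf fk fg.
have [B [bB Bg BD]] := bisection_base hX (deg_locally_constant (invg g)).
(* the only factorization of the unit with its right factor in [B] *)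
have comp_g : is_comp g (invg g) (unitg S (rng g)).
  by apply: is_compI => //; rewrite /deg/= subrr.
apply: (@ideal_support_unit (f ** \1_B)).
- exact/ideal_convr/steinberg_indic.
- move=> h /conv_neq0 [a [b [abh fa /indic_neq0 Bb]]].
  rewrite (is_comp_deg abh) (fk _ fa) (BD _ Bb) -(fk _ fg).
  by rewrite [deg (invg g)]/deg/= subrr.
- rewrite (conv_single comp_g) ?indic1 ?mulr1// => a b abx fa /indic_neq0 Bb.
  have bE : b = invg g.
    case: bB => _ _ _; apply; rewrite ?inE//.
    by rewrite -(is_comp_src abx).
  by move: abx; rewrite bE => /is_comp_inj_l; apply.
Qed.

(** The indicator of a bisection through [g] with sources in the support is
    itself in the ideal, and it is homogeneous. *)
Lemma ideal_support_arrow g : ideal_support (src g) -> ideal_support (rng g).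
Proof.
move=> [V [cV oV Vg JV]].
have gN : nbhs g ([set h | deg h = deg g] `&` @src X S @^-1` V).
  apply: filterI; first exact: deg_locally_constant.
  by apply: src_continuous; exact: open_nbhs_nbhs.
have [B [bB Bg BN]] := bisection_base hX gN.
apply: (@ideal_support_homogeneous (deg g) \1_B).
- suff -> : \1_B = \1_B ** idem V.
    exact/ideal_convl/JV/steinberg_indic.
  apply/funext => h; rewrite conv_unitr.
  have [Bh|nBh] := pselect (B h); last by rewrite indic0// mul0r.
  by rewrite [\1_V _]indicE mem_set ?mulr1//; have [] := BN _ Bh.
- by move=> h /indic_neq0 /BN [].
- by rewrite indic1 ?oner_eq0.
Qed.

Lemma open_ideal_support : open ideal_support.
Proof.
rewrite openE => x [V [cV oV Vx JV]].
by apply: filterS (open_nbhs_nbhs (conj oV Vx)) => y Vy; exists V.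
Qed.

Lemma ideal_support_invariant : dr_invariant S (~` ideal_support).
Proof.
split.
- move=> _ [x [nx Dx] <-] sx; apply: nx.
  have [g [_ rg sg _]] := @arrow_exists _ S x 1 0 (sigma x) (conj I Dx) I erefl.
  by rewrite -rg; apply: ideal_support_arrow; rewrite sg.
- move=> x [Dx nsx] Ox; apply: nsx => /=.
  have [g [_ rg sg _]] := @arrow_exists _ S (sigma x) 0 1 x I (conj I Dx) erefl.
  by rewrite -rg; apply: ideal_support_arrow; rewrite sg.
Qed.

Lemma ideal_finite_cover (s : seq (set X)) f :
  (forall V, V \in s -> [/\ compact V, open V & J (idem V)]) -> A f ->
  (forall g, f g != 0 -> exists2 V, V \in s & V (rng g)) -> J f.
Proof.
elim: s f => [|V s IHs] f sJ Af fs.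
  have -> : f = 0; last by case: idealJ => -[J0 _] _ _; exact: J0.
  by apply/funext => g; apply/eqP; apply: contraT => /fs [V]; rewrite in_nil.
have [cV oV JV] := sJ V (mem_head _ _).
have AV : A (idem V) by exact/steinberg_indic/bisection_unitg.
(* split [f] into its part over [V] and its part off [V] *)
rewrite -[f](subrK (idem V ** f)); apply: idealD; last exact: ideal_convr.
apply: IHs.
- by move=> V' V's; apply: sJ; rewrite in_cons V's orbT.
- rewrite addrC -scaleN1r; apply: lspan_linear => //; exact: steinberg_conv.
- move=> g; rewrite -[(f - _) g]/(f g - (idem V ** f) g) conv_unitl.
  have [Vg|nVg] := pselect (V (rng g)).
    by rewrite indicE mem_set// mul1r subrr eqxx.
  rewrite indicE memNset// mul0r subr0 => /fs [V' + V'g].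
  by rewrite in_cons => /orP[/eqP V'V|]; [case: nVg; rewrite -V'V|exists V'].
Qed.

(** The ranges of the support of [f] lie in a compact subset of the open set, so
    finitely many of the idempotents in [J] cover them. The filter used for
    compactness consists of the lists of such compact open sets, ordered by
    inclusion. *)
Lemma ideal_vanishing f : A f -> (forall g, ~ ideal_support (rng g) -> f g = 0) ->
  J f.
Proof.
move=> Af fO; have [C /compact_near_coveringP cov fC] := steinberg_compact_support Af.
pose good := [set s : seq (set X) |
  forall V, V \in s -> [/\ compact V, open V & J (idem V)]].
pose above (s : seq (set X)) := [set s' | good s' /\ {subset s <= s'}].
have FF : Filter (filter_from good above).
  apply: filter_from_filter; first by exists [::].
  move=> s s' gs gs'; exists (s ++ s').
    by move=> V; rewrite mem_cat => /orP[/gs|/gs'].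
  move=> t [gt st]; split; split=> // V Vs; apply: st.
    by rewrite mem_cat Vs.
  by rewrite mem_cat Vs orbT.
pose P (s : seq (set X)) g := f g != 0 -> exists2 V, V \in s & V (rng g).
have [] := cov _ _ P FF.
  move=> g _; have [fg0|fg] := eqVneq (f g) 0.
    exists ([set h | f h = f g], setT).
      by split; [exact: steinberg_locally_constant|exact: filterT].
    by move=> [h s] [/= fh _]; rewrite /P fh fg0 eqxx.
  have [V [cV oV Vg JV]] : ideal_support (rng g).
    by apply: contrapT => /fO fg0; rewrite fg0 eqxx in fg.
  exists (@rng X S @^-1` V, above [:: V]).
    split; first by apply: rng_continuous; exact: open_nbhs_nbhs.
    by exists [:: V] => // V'; rewrite inE => /eqP ->.
  by move=> [h s] [/= Vh [_ Vs]] _; exists V => //; apply: Vs; exact: mem_head.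
move=> s gs sP; apply: (ideal_finite_cover (s := s)) => // g fg.
by apply: (sP s (conj gs (fun _ => id)) g (fC _ fg)) fg.
Qed.

(** Isolating bisections through the finitely many arrows off the support
    interpolate any function there, and what remains lies in [J]. *)
Lemma finite_dim_quotient_ideal :
  finite_set [set g : G | ~ ideal_support (rng g)] -> finite_dim_quotient A J.
Proof.
move=> finG; pose D := fset_set [set g : G | ~ ideal_support (rng g)].
have /choice [N NP] := separating_bisection hX D.
exists [set (\1_(N g) : G -> K^o) | g in [set` D]]; split.
- by apply: finite_image; exact: finite_fset.
- by move=> _ [g _ <-]; apply: steinberg_indic; case: (NP g).
move=> a Aa; pose b : G -> K^o := \sum_(g <- D) a g *: (\1_(N g) : G -> K^o).
exists b.
  rewrite /b big_seq; elim/big_ind : _ => [|u v Bu Bv|g gD].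
  - exact: lspan0.
  - by rewrite -[u]scale1r; exact: lspan_linear.
  - by rewrite -[_ *: _]addr0; apply: lspan_cons; [exists g|exact: lspan0].
have Ab : A b.
  rewrite /b; elim/big_ind : _ => [|u v Bu Bv|g _].
  - exact: lspan0.
  - by rewrite -[u]scale1r; exact: lspan_linear.
  - rewrite -[_ *: _]addr0; apply: lspan_linear; last exact: lspan0.
    by apply: steinberg_indic; case: (NP g).
apply: ideal_vanishing.
  by rewrite addrC -scaleN1r; exact: lspan_linear.
move=> h Oh; have hD : h \in D by rewrite in_fset_set// inE.
suff bh : b h = a h by rewrite -[LHS]/(a h - b h) bh subrr.
rewrite /b (big_morph (fun f : G -> K^o => f h) (op1 := +%R) (id1 := 0))//.
rewrite (big_fsetD1 h)//= big1_fset => [|g].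
  rewrite addr0 -[LHS]/(a h * \1_(N h) h) indic1 ?mulr1//.
  by case: (NP h).
rewrite !inE => /andP[gh gD] _.
rewrite -[LHS]/(a g * \1_(N g) h) indic0 ?mulr0//.
by case: (NP g) => _ _; apply=> //; rewrite eq_sym.
Qed.

End IdealSupport.

(** The exponents of an arrow over [W] are bounded by the length of the longest
    orbit in [W], so finitely many triples are possible. *)
Lemma acyclic_finite_reduction (X : topologicalType) (S : dr_system X)
    (W : set X) : dr_invariant S W -> finite_set W ->
  dr_restr_iter_dom S W #|` fset_set W| = set0 ->
  finite_set [set g : dr_groupoid S | W (rng g)].
Proof.
move=> invW finW domW0; set N := #|` fset_set W| in domW0.
have short m x : W x -> dr_iter_dom S m x -> (m < N)%N.
  move=> Wx mx; rewrite ltnNge; apply/negP => Nm; suff : set0 x by [].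
  by rewrite -domW0; apply/(restr_iter_domP invW); split=> //; exact: dr_iter_dom_le mx.
pose degs := (fun mn : nat * nat => mn.1%:Z - mn.2%:Z) @` (`I_N `*` `I_N).
have fin : finite_set ((W `*` degs) `*` W).
  apply: finite_setX => //; apply: finite_setX => //.
  by apply: finite_image; apply: finite_setX; exact: finite_II.
have : finite_set (@dr_triple X S @^-1` ((W `*` degs) `*` W)).
  by apply: finite_preimage fin => g h _ _ /val_inj.
apply: sub_finite_set => g Wg.
have Wsg : W (src g) by apply/(invariant_arrow invW).
have [m [n [dg mg ng _]]] := lag_exists g.
split=> //; split=> //; exists (m, n); last by rewrite -dg.
by split; [exact: short mg|exact: short ng].
Qed.

Lemma direct_sum_nonzero (K : fieldType) (V : lmodType K) (J : set V)
    (F : int -> set V) v : is_direct_sum J F -> J v -> v != 0 ->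
  exists k w, F k w /\ w != 0.
Proof.
move=> [-> _] [w [wF _] <-] nz; apply: contrapT => nex.
move/eqP: nz; apply; apply: fsbig1 => k _; apply/eqP; apply: contra_notT nex => wk.
by exists k, (w k).
Qed.

(** * The equivalence *)

Theorem theorem6p14 (K : fieldType) (X : topologicalType) (S : dr_system X)
    (hX : totally_disconnected [set: X])
    (hinf : ~ finite_dim (@steinberg K X S)) :
  graded_just_infinite (@conv K X S) (@steinberg K X S) (@steinberg_deg K X S)
  <->
  (forall W : set X,
     W !=set0 -> W <> setT -> closed W -> dr_invariant S W ->
     finite_set W /\ dr_restr_iter_dom S W #|` fset_set W| = set0).
Proof.
split=> [ji W _ WT clW invW|fin].
  have finG := just_infinite_restriction hX clW WT invW ji.
  split; first exact: finite_reduction_unit_space finG.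
  exact: finite_reduction_no_long_path.
split=> // J [idealJ sumJ] J0; apply: finite_dim_quotient_ideal => //.
have [v [Jv v0]] : exists v, J v /\ v != 0.
  apply: contra_notP J0 => nex; apply/seteqP; split=> [v Jv|_ ->].
    by apply/eqP; apply: contra_notT nex => v0; exists v.
  by case: idealJ => -[].
have [k [w [[wk Jw] w0]]] := direct_sum_nonzero sumJ Jv v0.
have [g wg] : exists g, w g != 0.
  apply: contraTP w0 => nex; apply/negPn/eqP/funext => g; apply/eqP.
  by apply: contra_notT nex => ?; exists g.
have Og : ideal_support J (rng g).
  have wdeg a : w a != 0 -> deg a = k by exact: steinberg_deg_support.
  exact (ideal_support_homogeneous hX idealJ Jw wdeg wg).
have invW := ideal_support_invariant hX idealJ.
(* an empty complement means [J = A], the one case that (2) does not cover *)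
have [W0|/set0P WN0] := eqVneq (~` ideal_support J) set0.
  suff -> : [set g : dr_groupoid S | ~ ideal_support J (rng g)] = set0 by [].
  rewrite -subset0 => h Oh; suff : (set0 : set X) (rng h) by [].
  by rewrite -W0.
have [||finW domW0] := fin _ WN0 _ _ invW.
- by move=> WT; suff : (~` ideal_support J) (rng g) by []; rewrite WT.
- exact/open_closedC/open_ideal_support.
- exact (acyclic_finite_reduction invW finW domW0).
Qed.
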